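(* Let $W$ be a step-graphon, and let $\vec G_n\sim W$ denote the random digraph on $n$ nodes sampled from $W$. Then the following hold. 1. If $W$ fails to satisfy Condition $A$ or fails to satisfy Condition $B'$, then $\lim_{n\to\infty}\mathbf{P}(\vec G_n\sim W \text{ has a cycle cover})=0$. 2. If $W$ satisfies Conditions $A$ and $B$ but not Condition $C$, then $\lim_{n\to\infty}\mathbf{P}(\vec G_n\sim W\text{ has a cycle cover})=1$ and $\lim_{n\to\infty}\mathbf{P}(\vec G_n\sim W\text{ has a Hamilton cycle})=0$. 3. If $W$ satisfies Conditions $A$, $B$ and $C$, then $\lim_{n\to\infty}\mathbf{P}(\vec G_n\sim W\text{ has a Hamilton cycle})=1$.
   Context: A graphon is a measurable function $W:[0,1]^2\to[0,1]$, not necessarily symmetric. $W$ is a step-graphon if there is a sequence $0=\sigma_0<\sigma_1<\cdots<\sigma_m=1$ ($m\ge 1$) such that $W$ is constant on each rectangle $R_{ij}=[\sigma_{i-1},\sigma_i)\times[\sigma_{j-1},\sigma_j)$, $1\le i,j\le m$; $\sigma=(\sigma_0,\ldots,\sigma_m)$ is called a partition for $W$. Sampling $\vec G_n\sim W$: (S1) draw $t_1,\ldots,t_n$ independently and uniformly from $[0,1]$ ($t_i$ is the coordinate of node $v_i$); (S2) for each pair of distinct nodes $v_i,v_j$, independently place a directed edge $v_iv_j$ with probability $W(t_i,t_j)$ and a directed edge $v_jv_i$ with probability $W(t_j,t_i)$. A cycle cover of a digraph $\vec G$ is a subgraph with the same node set as $\vec G$ that is a node-wise disjoint union of directed cycles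 of $\vec G$ (2-cycles are allowed). A Hamilton cycle is a cycle cover consisting of a single cycle. Objects associated with $(W,\sigma)$: the concentration vector $x^*\in\mathbb{R}^m$, $x^*_i=\sigma_i-\sigma_{i-1}$; the skeleton graph $\vec S$, the digraph on nodes $u_1,\ldots,u_m$ (self-loops allowed) with an edge $u_iu_j$ iff $W$ is nonzero on $R_{ij}$; the node-cycle incidence matrix $Z=[z_1\,\cdots\,z_k]\in\mathbb{R}^{m\times k}$, where $\vec C_1,\ldots,\vec C_k$ are all the directed cycles of $\vec S$ (a self-loop is a cycle of length 1) and $z_j=\sum_{u_i\in V(\vec C_j)}e_i$; the node-circulation cone $\mathsf{X}=\{\sum_{j=1}^k c_jz_j : c_j\ge 0\}$. Put $\operatorname{co-rank}(Z)=m-\operatorname{rank}(Z)$. Conditions: ($A$) $\operatorname{co-rank}(Z)=0$; ($B$) $x^*$ lies in the relative interior of $\mathsf{X}$; ($B'$) $x^*\in\mathsf{X}$; ($C$) $\vec S$ is strongly connected. A step-graphon $W$ satisfies one of these conditions if there is a partition $\sigma$ for $W$ with $m\ge 2$ (so $\vec S$ has at least two nodes) whose associated $(x^*,\vec S,Z,\mathsf{X})$ satisfies it. *)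

(* Defs.v *)
From HB Require Import structures.
From mathcomp Require Import all_boot all_order all_algebra.
From mathcomp Require Import all_classical all_reals all_analysis.

Set Implicit Arguments.
Unset Strict Implicit.
Unset Printing Implicit Defensive.

Import Order.TTheory GRing.Theory Num.Theory.
Import numFieldNormedType.Exports.

Local Open Scope classical_set_scope.
Local Open Scope ring_scope.

Section Digraphs.
Variable V : finType.
Implicit Types (e : rel V) (c : seq V).

(* A directed cycle is given by the cyclic sequence of its distinct nodes;
   [:: u] is a self-loop and [:: u; v] a 2-cycle. *)
Definition dicycle e c : bool := [&& c != [::], uniq c & cycle e c].

Definition cycle_cover e (cs : seq (seq V)) : Prop :=
  [/\ {in cs, forall c, dicycle e c}, uniq (flatten cs)
    & forall v, v \in flatten cs].

Definition has_cycle_cover e : Prop := exists cs, cycle_cover e cs.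

Definition has_hamilton_cycle e : Prop := exists c, cycle_cover e [:: c].

Definition cycle_arcs c : {set V * V} := [set (u, next c u) | u in c]%SET.

(* Each directed cycle is identified with its set of arcs, so that rotations
   of the same cyclic sequence are counted once. *)
Definition dicycles e : {set {set V * V}} :=
  [set cycle_arcs c | c : #|V|.-bseq V & dicycle e c]%SET.

Definition cycle_nodes (C : {set V * V}) : {set V} := [set a.1 | a in C]%SET.

Definition strongly_connected e : Prop := forall u v, connect e u v.

End Digraphs.

Section RelativeInterior.
Variables (R : realType) (m : nat).
Implicit Type X : set 'cV[R]_m.

Definition affine_hull X : set 'cV[R]_m :=
  [set y | exists (k : nat) (a : 'I_k -> R) (v : 'I_k -> 'cV[R]_m),
     [/\ forall i, X (v i), \sum_i a i = 1 & y = \sum_i a i *: v i]].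

Definition relative_interior X : set 'cV[R]_m :=
  [set x | X x /\ \forall y \near x, affine_hull X y -> X y].

End RelativeInterior.

Section Graphons.
Variable R : realType.
Implicit Types (W : R * R -> R) (s : seq R).

Definition unit_square : set (R * R) := `[0, 1] `*` `[0, 1].

(* The values of W outside the unit square are irrelevant. *)
Definition graphon W : Prop :=
  measurable_fun unit_square W /\ forall p, unit_square p -> 0 <= W p <= 1.

(* A partition sigma is given by the sequence s of sigma_1, ..., sigma_m; thus
   m = size s, and sigma_0 = 0 is left implicit. *)
Definition sigma s (k : nat) : R := (0 :: s)`_k.

(* With indices starting at 0, this is the rectangle R_(i+1, j+1). *)
Definition rect s (i j : 'I_(size s)) : set (R * R) :=
  `[sigma s i, sigma s i.+1[ `*` `[sigma s j, sigma s j.+1[.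

Definition partition_for W s : Prop :=
  itv_partition 0 1 s /\
  forall i j p q, @rect s i j p -> @rect s i j q -> W p = W q.

Definition step_graphon W : Prop := graphon W /\ exists s, partition_for W s.

Definition concentration s : 'cV[R]_(size s) :=
  \col_i (sigma s i.+1 - sigma s i).

Definition skeleton W s : rel 'I_(size s) :=
  fun i j => `[< forall p, rect i j p -> W p != 0 >].

Definition incidence W s : 'M[R]_(size s, #|dicycles (@skeleton W s)|) :=
  \matrix_(i, j) (i \in cycle_nodes (enum_val j))%:R.

Definition corank W s : nat := size s - \rank (incidence W s).

Definition circulation_cone W s : set 'cV[R]_(size s) :=
  [set x | exists c : 'cV[R]_#|dicycles (@skeleton W s)|,
     (forall j, 0 <= c j 0) /\ x = incidence W s *m c].

Definition satisfies W (cond : (R * R -> R) -> seq R -> Prop) : Prop :=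
  exists s, [/\ partition_for W s, (1 < size s)%N & cond W s].

Definition condition_A W s : Prop := corank W s = 0%N.

Definition condition_B W s : Prop :=
  relative_interior (@circulation_cone W s) (concentration s).

Definition condition_B' W s : Prop :=
  @circulation_cone W s (concentration s).

Definition condition_C W s : Prop := strongly_connected (@skeleton W s).

End Graphons.

Section Sampling.
Context {R : realType} {d : measure_display} {Omega : measurableType d}.
Variable P : probability Omega R.

Definition uniform01 (X : {RV P >-> R}) : Prop :=
  forall B : set R, measurable B ->
    distribution P X B = uniform_prob (@ltr01 R) B.

(* Taking some of the B i to be setT gives the product rule for subfamilies. *)
Definition mutually_independent n (X : 'I_n -> {RV P >-> R}) : Prop :=
  forall B : 'I_n -> set R, (forall i, measurable (B i)) ->
    P (\bigcap_i (X i @^-1` B i)) = (\prod_(i < n) P (X i @^-1` B i))%E.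

(* Probability, given the coordinates x, that the set of edges is E, when each
   ordered pair (i, j) of distinct nodes is independently an edge with
   probability W (x i, x j). *)
Definition edges_prob (W : R * R -> R) n (x : 'I_n -> R)
    (E : {set 'I_n * 'I_n}) : R :=
  \prod_(a : 'I_n * 'I_n | a.1 != a.2)
    (if a \in E then W (x a.1, x a.2) else 1 - W (x a.1, x a.2)).

(* A digraph on the nodes 'I_n is given by its set of edges. The last clause
   says that edges_prob W x is the conditional law of G given the coordinates;
   as these lie in [0, 1] almost surely, it suffices to test on sets B i
   contained in [0, 1], where the values of W are meaningful. *)
Definition sampled_from (W : R * R -> R) n
    (G : Omega -> {set 'I_n * 'I_n}) : Prop :=
  exists t : 'I_n -> {RV P >-> R},
    [/\ forall i, uniform01 (t i), mutually_independent t,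
        forall E, measurable (G @^-1` [set E]),
        forall w i, (i, i) \notin G w
      & forall (B : 'I_n -> set R) (E : {set 'I_n * 'I_n}),
          (forall i, measurable (B i) /\ B i `<=` `[0, 1]) ->
          (forall i, (i, i) \notin E) ->
          P ((\bigcap_i (t i @^-1` B i)) `&` (G @^-1` [set E])) =
          (\int[P]_(w in \bigcap_i (t i @^-1` B i))
             (edges_prob W (t ^~ w) E)%:E)%E].

End Sampling.

Definition edge_rel n (E : {set 'I_n * 'I_n}) : rel 'I_n :=
  fun i j => (i, j) \in E.

(* Main.v *)
(** Nodes of the sampled digraph are typed by the step containing their
    coordinate, and every cycle of the digraph projects to a closed walk of the
    skeleton.  Hence a vector q that vanishes on all skeleton cycles (failure
    of A) forces sum_v q(type v) = 0, which an anti-concentration argument rules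
    out; and a vector q separating x* from X (Farkas, failure of B') forces
    sum_v q(type v) >= 0, which the law of large numbers rules out.  If the
    skeleton is not strongly connected, a Hamilton cycle cannot visit two steps
    u, v without a path from u to v.

    For existence, A and B say that q.x* > 0 for every q <> 0 that is
    nonnegative on the cycles.  Applied to q = 1_{N(I)} - 1_I, where N(I) is the
    out-neighbourhood of a set I of steps, this gives N(I) = I or
    |N(I)| > |I| in mass, which is Hall's condition for the steps.  As the sample
    is quasirandom between adjacent steps, Hall's condition passes to its nodes
    and a perfect matching from out-copies to in-copies is a cycle cover.  Under
    C, a small part of each step j is reserved, for each i, as matched from step
    i only; this makes the cycle cover generic enough for its cycles to be merged
    one by one through an exchange of four arcs, leaving a Hamilton cycle. *)


(* [satisfies] allows a different partition for each condition, so A and C are transferred to the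
   partition witnessing B before they are combined.

   Probabilities are computed in a finite model, where each node has a random type and each pair an
   independent arc, so that they are finite sums; measure theory only identifies the law of the
   digraph with this model.

   The existence part depends on the order of the constants. The balance gap [gam] comes first, then
   the mass of the reserved parts, then the density constant [K] and the degree fraction [1/D]; only
   afterwards is the size [e] above which compatible sets must span many arcs fixed as a tiny
   fraction of [n], small against both the gap and the degrees. A linear [e] is attainable because
   two linear sets span quadratically many pairs, which beats the [4^n] choices of the two sets.
   Smaller sets are out of reach of this bound and are controlled by minimum degrees, which is what
   rescues Hall's condition when [N(I) = I] leaves no slack.

   The reserved parts come from independent random marks on the nodes, so one concentration bound
   serves blocks and reserved parts alike. *)
From HB Require Import structures.
From mathcomp Require Import all_boot all_order all_algebra fingroup perm ring lra zify.
Require Import Defs.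

Set Implicit Arguments.
Unset Strict Implicit.
Unset Printing Implicit Defensive.
Import Order.TTheory GRing.Theory Num.Theory.


(** * Matchings in block digraphs *)

Section Hall.
Variable V : finType.
Implicit Types (r : rel V) (A X : {set V}).

Definition nbrs r A : {set V} := [set u | [exists v in A, r v u]].

Lemma nbrsP r A u : reflect (exists2 v, v \in A & r v u) (u \in nbrs r A).
Proof. by rewrite inE; apply: exists_inP. Qed.

(** Halmos-Vaughan induction. Relativizing to [X] lets the induction drop matched nodes on the left
    by shrinking [X] and on the right by shrinking [r]; values of [f] outside [X] are arbitrary. *)
Lemma hall_on r X :
    (forall A, A \subset X -> #|A| <= #|nbrs r A|) ->
  exists f : V -> V, {in X &, injective f} /\ {in X, forall v, r v (f v)}.
Proof.
have [k] := ubnP #|X|; elim: k r X => // k IHk r X leXk hall.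
have [->|[x Xx]] := set_0Vmem X.
  by exists id; split=> v; rewrite inE.
have restrict (Y : {set V}) Z : Y \subset X -> #|Y| < #|X| ->
    (forall A, A \subset Y -> #|A| <= #|nbrs r A :\: Z|) ->
  exists f : V -> V, {in Y &, injective f} /\
    {in Y, forall v, r v (f v) && (f v \notin Z)}.
  move=> sYX ltYX hY.
  have [||f [injf fP]] := IHk (fun v u => r v u && (u \notin Z)) Y.
  - by lia.
  - move=> A /hY /leq_trans; apply; apply/subset_leq_card/subsetP=> u.
    by rewrite inE => /andP[nZu /nbrsP[v Av rvu]]; apply/nbrsP; exists v; rewrite ?rvu.
  by exists f; split.
(* A tight proper subset [A] is matched on its own: since it has exactly [#|A|] neighbours,
   discarding them preserves Hall's condition on [X :\: A]. *)
have [/existsP[A /and4P[sAX A0 ltAX eqA]]|nA] := boolP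
    [exists A : {set V}, [&& A \subset X, A != set0, #|A| < #|X|
                           & #|nbrs r A| == #|A|]].
- have [|f [injf fP]] := restrict A set0 sAX ltAX.
    by move=> B sBA; rewrite setD0; apply: hall; apply: subset_trans sBA sAX.
  have [||g [injg gP]] := restrict (X :\: A) (nbrs r A) (subsetDl _ _).
  - rewrite cardsD (setIidPr sAX).
    by move: A0; rewrite -card_gt0; have := subset_leq_card sAX; lia.
  - move=> B sB.
    have dAB : [disjoint A & B].
      rewrite disjoint_sym; apply/pred0P=> v /=; apply/negP=> /andP[/(subsetP sB)].
      by rewrite inE => /andP[/negP].
    have := hall (A :|: B); rewrite subUset sAX (subset_trans sB (subsetDl _ _)).
    move: dAB; rewrite -(leq_card_setU A B).2 => /eqP -> /(_ isT).
    have -> : nbrs r (A :|: B) = nbrs r A :|: (nbrs r B :\: nbrs r A).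
      apply/setP=> u; rewrite !inE.
      apply/exists_inP/idP => [[v]|].
        rewrite inE => /orP[Av|Bv] rvu.
          by apply/orP; left; apply/exists_inP; exists v.
        case: exists_inP => //= _.
        by apply/exists_inP; exists v.
      case/orP=> [/exists_inP[v Av]|/andP[_ /exists_inP[v Bv]]] rvu;
        by exists v => //; rewrite inE ?Av ?Bv ?orbT.
    have := leq_card_setU (nbrs r A) (nbrs r B :\: nbrs r A).
    by move=> [+ _]; move/eqP: eqA; lia.
  exists (fun v => if v \in A then f v else g v); split=> [u v Xu Xv|v Xv].
    case: ifPn => Au; case: ifPn => Av E.
    - exact: injf E.
    - have /andP[_ /negP[]] : r v (g v) && (g v \notin nbrs r A).
        by apply: gP; rewrite inE Av.
      by rewrite -E; apply/nbrsP; exists u => //; have /andP[] := fP _ Au.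
    - have /andP[_ /negP[]] : r u (g u) && (g u \notin nbrs r A).
        by apply: gP; rewrite inE Au.
      by rewrite E; apply/nbrsP; exists v => //; have /andP[] := fP _ Av.
    - by apply: injg E; rewrite inE ?Au ?Av.
  case: ifPn => Av; first by have /andP[] := fP _ Av.
  by have /andP[] : r v (g v) && (g v \notin nbrs r A) by apply: gP; rewrite inE Av.
(* With no tight proper subset, every nonempty one has a neighbour to spare, so [x] may take any
   neighbour [y]. *)
- have [N0|[y /nbrsP[x' /set1P-> rxy]]] := set_0Vmem (nbrs r [set x]).
    by have := hall [set x]; rewrite sub1set Xx cards1 N0 cards0 => /(_ isT).
  have [||f [injf fP]] := restrict (X :\ x) [set y] (subD1set _ _).
  - by rewrite [in leqRHS](cardsD1 x) Xx.
  - move=> A sA.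
    have [->|A0] := eqVneq A set0; first by rewrite cards0.
    have sAX := subset_trans sA (subD1set X x).
    have ltAX : #|A| < #|X|.
      by rewrite [in leqRHS](cardsD1 x) Xx; apply: subset_leq_card.
    have := hall _ sAX; move: nA; rewrite negb_exists => /forallP/(_ A).
    rewrite sAX A0 ltAX /= => neA leA; have := cardsD1 y (nbrs r A).
    by case: (y \in _); lia.
  exists (fun v => if v == x then y else f v); split=> [u v Xu Xv|v Xv].
    case: eqVneq => [->|ux]; case: eqVneq => [->|vx] // E.
    - have /andP[_] : r v (f v) && (f v \notin [set y]) by apply: fP; rewrite !inE vx.
      by rewrite -E inE eqxx.
    - have /andP[_] : r u (f u) && (f u \notin [set y]) by apply: fP; rewrite !inE ux.
      by rewrite E inE eqxx.
    - by apply: injf => //; rewrite !inE ?ux ?vx.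
  case: eqVneq => [->//|vx].
  by have /andP[] : r v (f v) && (f v \notin [set y]) by apply: fP; rewrite !inE vx.
Qed.

Lemma hall r : (forall A, #|A| <= #|nbrs r A|) ->
  exists s : {perm V}, forall v, r v (s v).
Proof.
move=> hr; have [|f [injf fP]] := @hall_on r setT; first by move=> A _.
have inj : injective f by move=> u v; apply: injf; rewrite inE.
by exists (perm inj) => v; rewrite permE; apply: fP; rewrite inE.
Qed.
End Hall.

Lemma card_fibers (V T : finType) (h : V -> T) (A : {set V}) :
  #|A| = \sum_i #|A :&: h @^-1: [set i]|.
Proof.
rewrite -sum1_card (partition_big h predT) //=; apply: eq_bigr => i _.
by rewrite -sum1_card; apply: eq_bigl => v; rewrite !inE.
Qed.

Lemma leq_card_fibers (V T : finType) (h : V -> T) (A : {set V}) e :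
  (forall i, #|A :&: h @^-1: [set i]| <= e) -> #|A| <= #|T| * e.
Proof.
by move=> le_e; rewrite (card_fibers h) -sum_nat_const; apply: leq_sum.
Qed.

Section BlockHall.
Variables (V T F : finType) (tau : V -> T) (f : V -> F) (S : T -> F -> bool).
Variables (E : rel V) (e d g : nat).
Implicit Types (A B : {set V}) (I : {set T}).

Definition targets I : {set F} := [set j | [exists i in I, S i j]].

Lemma targetsP I j : reflect (exists2 i, i \in I & S i j) (j \in targets I).
Proof. by rewrite inE; apply: exists_inP. Qed.

Hypothesis large_edge : forall A B,
  {in A & B, forall a b, S (tau a) (f b)} -> e <= #|A| -> e <= #|B| ->
  exists a b, [/\ a \in A, b \in B & E a b].
Hypothesis outdeg : forall v j, S (tau v) j ->
  d <= #|[set u in f @^-1: [set j] | E v u]|.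
Hypothesis indeg : forall v i, S i (f v) ->
  d <= #|[set u in tau @^-1: [set i] | E u v]|.
Hypothesis gap : forall I,
  #|tau @^-1: I| = #|f @^-1: targets I| \/
  #|tau @^-1: I| + g <= #|f @^-1: targets I|.
Hypotheses (le_eg : (#|T| + #|F|) * e <= g) (lt_ed : (#|T| + #|F|) * e < d).

Definition compat_edge : rel V := fun v u => E v u && S (tau v) (f u).

(** Up to [#|T| * e] nodes, [A] lies in the blocks [I] that it meets in at least [e] nodes, and by
    [large_edge] its neighbours miss at most [#|F| * e] nodes of the types in [targets I]. A strict
    gap absorbs both errors; in the case of equality one vertex of degree [d] has to make up for
    them. *)
Lemma block_hall_card A : #|A| <= #|nbrs compat_edge A|.
Proof.
pose I := [set i | e <= #|A :&: tau @^-1: [set i]|].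
set N := nbrs _ A; set tI := f @^-1: targets I.
have sizeA : #|A| <= #|A :&: tau @^-1: I| + #|T| * e.
  rewrite -(cardsID (tau @^-1: I)) leq_add2l; apply: (leq_card_fibers (h := tau)).
  move=> i; have [Ii|nIi] := boolP (i \in I).
    suff -> : (A :\: tau @^-1: I) :&: tau @^-1: [set i] = set0 by rewrite cards0.
    apply/setP=> v; rewrite !inE; case: (tau v =P i) => [->|]; rewrite ?andbF //.
    by move: Ii; rewrite inE => ->.
  apply: leq_trans (subset_leq_card _) (_ : #|A :&: tau @^-1: [set i]| <= e).
    by rewrite setSI // subsetDl.
  by move: nIi; rewrite inE -ltnNge => /ltnW.
have missed : #|tI :\: N| <= #|F| * e.
  apply: (leq_card_fibers (h := f)) => j.
  have [/targetsP[i Ii Sij]|nIj] := boolP (j \in targets I); last first.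
    suff -> : (tI :\: N) :&: f @^-1: [set j] = set0 by rewrite cards0.
    apply/setP=> v; rewrite !inE; case: (f v =P j) => [->|]; rewrite ?andbF //.
    by move: nIj; rewrite inE => /negbTE->; rewrite andbF.
  rewrite leqNgt; apply/negP=> /ltnW lt_e.
  have [||a [b []]] := large_edge (A := A :&: tau @^-1: [set i]) _ _ lt_e.
  - by move=> a b; rewrite !inE => /andP[_ /eqP->] /andP[_ /eqP->].
  - by move: Ii; rewrite inE.
  rewrite !inE => /andP[Aa /eqP Ta] /andP[/andP[nNb _] /eqP Tb] Eab.
  by case/negP: nNb; apply/exists_inP; exists a => //; rewrite /compat_edge Eab Ta Tb.
have hit : #|tI| <= #|N :&: tI| + #|F| * e.
  by rewrite -(cardsID N tI) setIC leq_add2l.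
have leN : #|N :&: tI| <= #|N| by rewrite subset_leq_card ?subsetIl.
have leI : #|A :&: tau @^-1: I| <= #|tau @^-1: I| by rewrite subset_leq_card ?subsetIr.
have := gap I; rewrite -/tI => -[eqI|ltI]; last by lia.
have [sAI|/subsetPn[v Av nIv]] := boolP (A \subset tau @^-1: I).
  have [M0|[u]] := set_0Vmem (tI :\: N).
    have /subset_leq_card : tI \subset N by rewrite -setD_eq0 M0.
    by have := subset_leq_card sAI; rewrite eqI; lia.
  (* A missed target [u] has [d] in-neighbours in block [i], and none of them is in [A]: so [A]
     falls short of its blocks by [d]. *)
  rewrite !inE => /andP[nNu /exists_inP[i Ii Siu]].
  have dB := indeg Siu; set B := [set _ in _ | _] in dB.
  have : #|A| + #|B| <= #|tau @^-1: I|.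
    have dAB : A :&: B = set0.
      apply/setP=> w; rewrite !inE; apply/negP=> /and3P[Aw /eqP Tw Ewu].
      by case/negP: nNu; apply/exists_inP; exists w; rewrite // /compat_edge Ewu Tw.
    rewrite -cardsUI dAB cards0 addn0 subset_leq_card // subUset sAI.
    by apply/subsetP=> w; rewrite !inE => /andP[/eqP-> _]; move: Ii; rewrite inE.
  by lia.
(* Adding the type of [v] enlarges the left side strictly, and the right side is at least as large
   as the left one for [J]. So [v] has a target type outside [targets I], and its [d] out-neighbours
   there are not yet counted. *)
set J := tau v |: I.
have ltIJ : #|tau @^-1: I| < #|tau @^-1: J|.
  apply: proper_card; apply/properP; split.
    by apply: preimsetS; apply: subsetUr.
  by exists v; rewrite ?inE ?eqxx //; move: nIv; rewrite !inE.
have /subsetPn[u] : ~~ (f @^-1: targets J \subset tI).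
  apply/negP=> /subset_leq_card; case: (gap J); lia.
rewrite !inE => /exists_inP[i]; rewrite !inE => /predU1P[-> Svu|Ii Siu]; last first.
  by move=> /exists_inP[]; exists i; rewrite // inE.
move=> /exists_inP nIu; have dB := outdeg Svu; set B := [set _ in _ | _] in dB.
have : #|N :&: tI| + #|B| <= #|N|.
  have dNB : N :&: tI :&: B = set0.
    apply/setP=> w; rewrite !inE; apply/negP=> /and3P[/andP[_ tIw] /eqP Tw _].
    by case: nIu; move: tIw; rewrite Tw => /exists_inP.
  rewrite -cardsUI dNB cards0 addn0 subset_leq_card // subUset subsetIl.
  apply/subsetP=> w; rewrite !inE => /andP[/eqP Tw Evw].
  by apply/exists_inP; exists v; rewrite // /compat_edge Evw Tw.
lia.
Qed.
End BlockHall.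

(** * Merging the cycles of a permutation *)

Section Merge.
Variable V : finType.
Implicit Types (s : {perm V}) (A B C D U : {set V}).

Lemma porbit_sub s U x : (forall v, v \in U -> s v \in U) -> x \in U ->
  porbit s x \subset U.
Proof.
move=> sU Ux; apply/subsetP=> y /porbitP[i ->]; rewrite permX.
by elim: i => //= i; apply: sU.
Qed.

Lemma porbit_fconnect s x y : (y \in porbit s x) = fconnect s x y.
Proof.
apply/idP/idP=> [/porbitP[i ->]|/iter_findex <-]; rewrite ?permX ?fconnect_iter //.
by rewrite -permX mem_porbit.
Qed.

(* [pos s] is an injective numbering of the nodes that increases by one along
   each arc [v -> s v], except on the arc closing each cycle. *)
Definition orbit_pos s v := findex s (froot s v) v.

Definition pos s v := enum_rank (froot s v) * #|V| + orbit_pos s v.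

Lemma ltn_orbit_pos s v : orbit_pos s v < #|V|.
Proof.
have fc : fconnect s (froot s v) v.
  by rewrite fconnect_sym ?connect_root //; apply: perm_inj.
by apply: leq_trans (findex_max fc) _; apply: max_card.
Qed.

Lemma pos_inj s : injective (pos s).
Proof.
move=> u v; rewrite /pos => E.
have fc w : fconnect s (froot s w) w.
  by rewrite fconnect_sym ?connect_root //; apply: perm_inj.
have V0 : 0 < #|V| by apply: leq_ltn_trans (ltn_orbit_pos s v).
have Er : froot s u = froot s v.
  apply: enum_rank_inj; apply: val_inj => /=.
  move/(congr1 (fun k => k %/ #|V|)): E.
  by rewrite !divnMDl // !divn_small ?ltn_orbit_pos // !addn0.
move: E; rewrite Er => /addnI Ep.
by rewrite -(iter_findex (fc u)) -(iter_findex (fc v)) -/(orbit_pos s u) Ep Er.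
Qed.

Lemma pos_ltE s u v : v \in porbit s u ->
  (pos s u < pos s v) = (orbit_pos s u < orbit_pos s v).
Proof.
rewrite porbit_fconnect => /(fingraph.rootP (fconnect_sym (@perm_inj _ s))) Er.
by rewrite /pos -Er ltn_add2l.
Qed.

Lemma orbit_pos_step s v w : w \in porbit s v -> orbit_pos s v < orbit_pos s w ->
  orbit_pos s (s v) = (orbit_pos s v).+1.
Proof.
have symc := fconnect_sym (@perm_inj _ s).
rewrite porbit_fconnect => /(fingraph.rootP symc) Er lt_vw.
have fc x : fconnect s (froot s x) x by rewrite symc connect_root.
have Es : froot s (s v) = froot s v.
  by apply/eqP; rewrite eq_sym root_connect // fconnect1.
rewrite /orbit_pos Es -{2}(iter_findex (fc v)) -iterS findex_iter //.
apply: leq_ltn_trans lt_vw _; rewrite /orbit_pos -Er.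
by apply: findex_max; rewrite Er.
Qed.

(* The arcs leaving a, b, x, c are redirected along a -> s b, b -> s x,
   x -> s c, c -> s a.  When a lies on a cycle of its own and c does not come
   between b and x, this merges cycles. *)
Definition exchange s a b x c := (tperm x c * (tperm b x * (tperm a b * s)))%g.

Section Exchange.
Variables (s : {perm V}) (a b x c : V).
Hypotheses (ab : b \notin porbit s a) (ax : x \notin porbit s a).
Hypotheses (ac : c \notin porbit s a).
Hypotheses (bx : pos s b < pos s x) (xc : (pos s c < pos s b) || (pos s x < pos s c)).

Let neqs : [/\ a != b, a != x, a != c & [/\ b != x, b != c & x != c]].
Proof.
split; try by [apply: contraNneq ab => <-; apply: porbit_id
  | apply: contraNneq ax => <-; apply: porbit_id
  | apply: contraNneq ac => <-; apply: porbit_id].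
have nb : b != x by apply/eqP=> E; move: bx; rewrite E ltnn.
split=> //; first by apply/eqP=> E; move: bx xc; rewrite E ltnn; lia.
by apply/eqP=> E; move: bx xc; rewrite E ltnn; lia.
Qed.

Lemma exchangeE v : exchange s a b x c v =
  s (if v == a then b else if v == b then x else if v == x then c
     else if v == c then a else v).
Proof.
have [nab nax nac [nbx nbc nxc]] := neqs.
rewrite /exchange !permM; congr (s _).
have [->|na] := eqVneq v a.
  by rewrite (tpermD (x := x)) 1?eq_sym // (tpermD (x := b)) 1?eq_sym // tpermL.
have [->|nb] := eqVneq v b.
  rewrite (tpermD (x := x)) 1?eq_sym // tpermL (tpermD (x := a)) //.
have [->|nx] := eqVneq v x.
  by rewrite tpermL (tpermD (x := b)) // tpermD.
have [->|nc] := eqVneq v c.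
  by rewrite tpermR tpermR tpermR.
by rewrite !tpermD // eq_sym.
Qed.

(** Each of the three transpositions changes the number of cycles by one. The first joins the cycle
    of [a] to that of [b]. If the second also joins, the total is negative whatever the third does;
    if the second splits, the position of [c] forces the third to join. *)
Lemma card_porbits_exchange : #|porbits (exchange s a b x c)| < #|porbits s|.
Proof.
have [nab nax nac [nbx nbc nxc]] := neqs.
set s1 := (tperm a b * s)%g; set s2 := (tperm b x * s1)%g.
have s1E v : s1 v = s (tperm a b v) by rewrite permM.
have s2E v : s2 v = s (tperm a b (tperm b x v)) by rewrite !permM.
have := porbits_mul_tperm s2 x c; have := porbits_mul_tperm s1 b x.
have := porbits_mul_tperm s a b; rewrite /= -/s1 -/s2 -/(exchange s a b x c).
rewrite nab nbx nxc porbit_sym ab.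
have [b1x|_] := boolP (b \in porbit s1 x); last first.
  by case: (x \notin _); move: #|_| #|_| #|_| #|_|; clear; lia.
suff -> : x \notin porbit s2 c by move: #|_| #|_| #|_| #|_|; clear; lia.
have sx y z : z \in porbit s y -> s z \in porbit s y.
  by rewrite !porbit_fconnect => /connect_trans; apply; apply: fconnect1.
have sbx : x \in porbit s b.
  have : x \in porbit s a :|: porbit s b.
    have /subsetP : porbit s1 b \subset porbit s a :|: porbit s b.
      apply: porbit_sub => [v|]; last by rewrite inE porbit_id orbT.
      rewrite s1E; case: tpermP => [->|->|_ _]; rewrite !inE.
      - by move=> _; apply/orP; right; rewrite sx ?porbit_id.
      - by move=> _; apply/orP; left; rewrite sx ?porbit_id.
      - by case/orP=> /sx ->; rewrite ?orbT.
    by apply; rewrite porbit_sym.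
  by rewrite inE (negbTE ax).
(* The cycle of [x] split off by the second transposition consists of the old cycle of [a] and of
   the segment after [b] up to [x]. Closure of [U] under [s2] is enough: [U] contains [x] but not
   [c]. *)
pose U := porbit s a :|:
  [set v in porbit s b | orbit_pos s b < orbit_pos s v <= orbit_pos s x].
have oP v : v \in porbit s b -> porbit s v = porbit s b.
  by move=> vb; apply/eqP; rewrite eq_porbit_mem.
have ltbx : orbit_pos s b < orbit_pos s x by rewrite -pos_ltE.
have nUc : c \notin U.
  rewrite !inE (negbTE ac) /=; apply/negP=> /and3P[cb lt1 lt2].
  have bc : b \in porbit s c by rewrite porbit_sym.
  have xc' : c \in porbit s x by rewrite oP.
  by move: xc; rewrite (pos_ltE bc) (pos_ltE xc') ltnNge (ltnW lt1) /= ltnNge lt2.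
rewrite porbit_sym; apply: contraNN nUc; apply/subsetP.
apply: porbit_sub => [v|]; last by rewrite !inE sbx leqnn ltbx orbT.
rewrite s2E; have [->|vb] := eqVneq v b.
  by rewrite !inE (negbTE ab) ltnn andbF.
have [->|vx] := eqVneq v x; first by move=> _; rewrite tpermR tpermR inE sx ?porbit_id.
rewrite [tperm b x v]tpermD 1?eq_sym //; have [->|va] := eqVneq v a.
  move=> _; rewrite tpermL !inE; apply/orP; right.
  by rewrite sx ?porbit_id // (orbit_pos_step (w := x)) // ltnSn ltbx.
rewrite tpermD 1?eq_sym // !inE => /orP[/sx->//|/and3P[vb' lt1 lt2]].
have lt_vx : orbit_pos s v < orbit_pos s x.
  rewrite ltn_neqAle lt2 andbT; apply: contraNneq vx => E.
  apply/eqP/(@pos_inj s); rewrite /pos E; congr (_ * _ + _); congr (enum_rank _).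
  apply/(fingraph.rootP (fconnect_sym (@perm_inj _ s))).
  by rewrite -porbit_fconnect oP.
apply/orP; right.
by rewrite sx // (orbit_pos_step (w := x)) ?oP // lt_vx ltnW // ltnS ltnW.
Qed.
End Exchange.
End Merge.

Lemma initial_segment (V : finType) (p : V -> nat) (B : {set V}) k :
  injective p -> k <= #|B| -> exists B0 : {set V},
  [/\ B0 \subset B, #|B0| = k & {in B0 & B :\: B0, forall b c, p b < p c}].
Proof.
move=> inj_p; elim: k => [|k IHk] lek.
  by exists set0; split; rewrite ?sub0set ?cards0 // => b c; rewrite inE.
have [B0 [sB0 cB0 ltB0]] := IHk (ltnW lek).
have [E|[z Bz]] := set_0Vmem (B :\: B0).
  by move: E => /eqP; rewrite setD_eq0 => /subset_leq_card; rewrite cB0 leqNgt lek.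
have [y By miny] := @arg_minnP V z [in B :\: B0] p Bz.
move: (By); rewrite /= inE => /andP[nB0y B'y].
exists (y |: B0); split.
- by rewrite subUset sub1set B'y sB0.
- by rewrite cardsU1 nB0y cB0.
move=> b c; rewrite !inE negb_or => /orP[/eqP->|B0b] /andP[/andP[ncy nB0c] Bc].
  rewrite ltn_neqAle miny ?andbT; last by rewrite inE nB0c.
  by apply: contraNneq ncy => /inj_p ->.
by apply: ltB0 => //; rewrite inE nB0c.
Qed.

(** Cut [B] into four consecutive pieces of size at least [k]. Either [k] elements of [C] come after
    the whole second piece, and the first two pieces serve, or [k] elements of [C] come before the
    third one, and the last two serve. *)
Lemma quartiles (V : finType) (p : V -> nat) (B C : {set V}) k :
  injective p -> 4 * k <= #|B| -> 2 * k <= #|C| ->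
  exists B0 X0 C0 : {set V},
  [/\ [/\ B0 \subset B, X0 \subset B & C0 \subset C],
      k <= #|B0|, k <= #|X0| & k <= #|C0|] /\
  forall b x c, b \in B0 -> x \in X0 -> c \in C0 ->
     p b < p x /\ (p c < p b) || (p x < p c).
Proof.
move=> inj_p leB leC.
have [|B1 [sB1 cB1 lt1]] := @initial_segment _ p B k inj_p; first by lia.
have [|B2 [sB2 cB2 lt2]] := @initial_segment _ p (B :\: B1) k inj_p.
  by rewrite cardsDS // cB1; lia.
have [|B3 [sB3 cB3 lt3]] := @initial_segment _ p (B :\: B1 :\: B2) k inj_p.
  by rewrite !cardsDS // cB1 cB2; lia.
set B4 := B :\: B1 :\: B2 :\: B3 in lt3.
have cB4 : k <= #|B4| by rewrite !cardsDS // cB1 cB2 cB3; lia.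
pose hi := [set c in C | [forall x in B2, p x < p c]].
have sD (X Y : {set V}) : X :\: Y \subset X by apply: subsetDl.
have sB2' : B2 \subset B by apply: subset_trans sB2 (sD _ _).
have sB3' : B3 \subset B.
  by apply: subset_trans sB3 (subset_trans (sD _ _) (sD _ _)).
have sB4' : B4 \subset B.
  by apply: subset_trans (sD _ _) (subset_trans (sD _ _) (sD _ _)).
have [lehi|] := leqP k #|hi|.
  exists B1, B2, hi; split; first by rewrite cB1 cB2; split=> //; split=> //;
    apply/subsetP=> v; rewrite inE => /andP[].
  move=> b x c B1b B2x; rewrite inE => /andP[_ /forall_inP ltc]; rewrite ltc // orbT.
  by split=> //; apply: lt1 => //; apply: (subsetP sB2).
move=> lthi; exists B3, B4, (C :\: hi); split.
  rewrite cB3; split=> //; have := cardsID hi C; have := subsetIr C hi.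
  by move/subset_leq_card; move: #|_| #|_| #|_| #|_| lthi leC; lia.
move=> b x c B3b B4x; rewrite !inE => /andP[+ Cc]; rewrite Cc /=.
case/forall_inPn=> y B2y; rewrite -leqNgt => lecy; split; first exact: lt3.
apply/orP; left; apply: leq_ltn_trans lecy _; apply: lt2 => //.
exact: (subsetP sB3).
Qed.

Section MergeStep.
Variables (V : finType) (E : rel V) (s : {perm V}) (D : {set V}) (e : nat).
Hypothesis sE : forall v, E v (s v).
Hypothesis large_edge : forall X Y : {set V}, X \subset D -> Y \subset D ->
  e <= #|X| -> e <= #|Y| -> exists x y, [/\ x \in X, y \in Y & E x (s y)].

(** The arcs at [a] are given by [B] and [C]; the two others, [b -> s x] and [x -> s c], come from
    density. Fewer than [2 * e] candidates [x] lack one of them, hence [quartiles] is applied with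
    [k = 2 * e], which explains [8 * e] and [4 * e]. Since the exchange permutes tails inside [D],
    the heads of a set that contains or avoids [D] are unchanged. *)
Lemma merge_step a (B C : {set V}) : a \in D ->
    B \subset D :\: porbit s a -> C \subset D :\: porbit s a ->
    {in B, forall b, E a (s b)} -> {in C, forall c, E c (s a)} ->
    8 * e <= #|B| -> 4 * e <= #|C| -> 0 < e ->
  exists t : {perm V}, [/\ forall v, E v (t v), #|porbits t| < #|porbits s|
    & forall A : {set V}, D \subset A \/ [disjoint A & D] -> t @: A = s @: A].
Proof.
move=> Da /subsetP sB /subsetP sC aB aC leB leC e0.
have [||B0 [X0 [C0 [[[sB0 sX0 sC0] cB0 cX0 cC0] ltBX]]]] :=
  @quartiles _ (pos s) B C (2 * e) (@pos_inj _ s) _ _; [lia|lia|].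
have sBD : B \subset D by apply/subsetP=> v /sB; rewrite inE => /andP[].
have sCD : C \subset D by apply/subsetP=> v /sC; rewrite inE => /andP[].
pose bad1 := [set x in X0 | [forall b in B0, ~~ E b (s x)]].
pose bad2 := [set x in X0 | [forall c in C0, ~~ E x (s c)]].
have lt1 : #|bad1| < e.
  rewrite ltnNge; apply/negP=> le1.
  have [|||b [x [B0b]]] := large_edge (X := B0) (Y := bad1) _ _ _ le1.
  - exact: subset_trans sB0 sBD.
  - by apply: subset_trans sBD; apply: subset_trans sX0; apply/subsetP=> v;
      rewrite inE => /andP[].
  - by lia.
  by rewrite inE => /andP[_ /forall_inP/(_ b B0b)/negP].
have lt2 : #|bad2| < e.
  rewrite ltnNge; apply/negP=> le2.
  have [|||x [c [+ C0c]]] := large_edge (X := bad2) (Y := C0) _ _ le2 _.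
  - by apply: subset_trans sBD; apply: subset_trans sX0; apply/subsetP=> v;
      rewrite inE => /andP[].
  - exact: subset_trans sC0 sCD.
  - by lia.
  by rewrite inE => /andP[_ /forall_inP/(_ c C0c)/negP].
have [E0|[x]] := set_0Vmem (X0 :\: (bad1 :|: bad2)).
  have := leq_card_setU bad1 bad2; case=> + _.
  by move: E0 => /eqP; rewrite setD_eq0 => /subset_leq_card; lia.
rewrite !inE => /andP[+ X0x]; rewrite X0x /= negb_or.
case/andP=> /forall_inPn[b B0b /negPn Ebx] /forall_inPn[c C0c /negPn Exc].
have [bx xc] := ltBX _ _ _ B0b X0x C0c.
have Bb := subsetP sB0 _ B0b; have Bx := subsetP sX0 _ X0x.
have Cc := subsetP sC0 _ C0c.
have := sB _ Bb; rewrite inE => /andP[ab Db].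
have := sB _ Bx; rewrite inE => /andP[ax Dx].
have := sC _ Cc; rewrite inE => /andP[ac Dc].
exists (exchange s a b x c); split.
- move=> v; rewrite exchangeE //.
  case: eqVneq => [->|_]; first exact: aB.
  case: eqVneq => [->//|_]; case: eqVneq => [->//|_].
  by case: eqVneq => [->|_]; first exact: aC.
- exact: card_porbits_exchange.
move=> A DA; have inj_t := @perm_inj _ (exchange s a b x c).
apply/eqP; rewrite eqEcard !card_imset //; last exact: perm_inj.
rewrite leqnn andbT; apply/subsetP=> _ /imsetP[v Av ->]; rewrite exchangeE //.
apply: imset_f; case: DA => [/subsetP DA|dAD].
  by do 4![case: eqVneq => _; first exact: DA].
have nD w : w \in D -> (v == w) = false.
  move=> Dw; apply: contraTF Av => /eqP->; apply: contraTN Dw => Aw.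
  by rewrite (disjointFr dAD).
by rewrite !nD.
Qed.
End MergeStep.

Section SingleOrbit.
Variables (V T : finType) (tau : V -> T) (S : rel T) (E : rel V).
Variables (H : T -> {set V}) (e d q h K : nat).
Implicit Types (A B : {set V}) (s t : {perm V}).
Notation blk i := (tau @^-1: [set i]).

Hypothesis E_sub : forall u v, E u v -> S (tau u) (tau v).
Hypothesis dense_out : forall A B,
  {in A & B, forall a b, S (tau a) (tau b)} -> e <= #|A| -> e <= #|B| ->
  exists2 a, a \in A & #|B| <= K * #|[set b in B | E a b]|.
Hypothesis dense_in : forall A B,
  {in A & B, forall a b, S (tau a) (tau b)} -> e <= #|A| -> e <= #|B| ->
  exists2 b, b \in B & #|A| <= K * #|[set a in A | E a b]|.
Hypothesis indeg : forall v i, S i (tau v) -> d <= #|[set u in blk i | E u v]|.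
Hypothesis headdeg : forall v, q <= #|[set u in H (tau v) | E v u]|.
Hypothesis heads : forall i j, S i j -> exists2 u, u \in H i & tau u = j.
Hypothesis S_conn : forall i j, connect S i j.
Hypotheses (e_gt0 : 0 < e) (le_q : h + 8 * e <= q) (le_d : h + 4 * e <= d).
Hypotheses (le_h : 8 * e * K <= h) (le_h2 : 2 * e <= h).

(* Exchanges take place among nodes of one block, so they keep the set [H i] of
   the heads of the arcs leaving block [i]; a cycle cover with fewest cycles
   among those with these heads has only one. *)
Lemma single_orbit s : (forall v, E v (s v)) -> (forall i, s @: blk i = H i) ->
  exists t, (forall v, E v (t v)) /\ forall u v, u \in porbit t v.
Proof.
move=> sE sH.
pose ok t := [forall v, E v (t v)] && [forall i, t @: blk i == H i].
have ok_s : ok s by apply/andP; split; apply/forallP=> v; rewrite ?sH.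
have [t ok_t mint] := @arg_minnP _ s ok (fun t => #|porbits t|) ok_s.
move: (ok_t) => /andP[/forallP tE /forallP tH].
exists t; split=> //.
have no_merge a (B C : {set V}) : B \subset blk (tau a) :\: porbit t a ->
    C \subset blk (tau a) :\: porbit t a ->
    {in B, forall b, E a (t b)} -> {in C, forall c, E c (t a)} ->
    8 * e <= #|B| -> 4 * e <= #|C| -> False.
  move=> sB sC aB aC leB leC.
  have [||t' [t'E lt_t' t'H]] := 
    merge_step (e := e) tE (D := blk (tau a)) _ _ sB sC aB aC leB leC e_gt0.
  - move=> X Y /subsetP sX /subsetP sY leX leY.
    have [||x Xx] := @dense_out X (t @: Y) _ leX.
    + move=> x _ Xx /imsetP[y Yy ->].
      move/sX: Xx (sY _ Yy); rewrite !inE => /eqP-> /eqP<-.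
      by apply: E_sub.
    + by rewrite card_imset //; apply: perm_inj.
    rewrite card_imset; last exact: perm_inj.
    case: (set_0Vmem [set b in t @: Y | E x b]) => [->|[b]].
      by rewrite cards0 muln0; lia.
    by rewrite inE => /andP[/imsetP[y Yy ->] Exy] _; exists x, y.
  - by rewrite !inE.
  have : ok t'.
    apply/andP; split; apply/forallP=> // i; rewrite t'H //.
    have [->|ni] := eqVneq i (tau a); [by left|right].
    apply/pred0P=> v /=; rewrite !inE.
    by apply/negP=> /andP[/eqP->]; rewrite (negbTE ni).
  by move/mint; rewrite leqNgt lt_t'.
have sx v w : w \in porbit t v -> t w \in porbit t v.
  by rewrite !porbit_fconnect => /connect_trans; apply; apply: fconnect1.
(* Otherwise, of the [q] admissible heads for [a] and the [d] tails for [t a], at least [8 * e] and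
   [4 * e] belong to other cycles, and a merge is possible. *)
have many a : h < #|blk (tau a) :&: porbit t a|.
  rewrite ltnNge; apply/negP=> leh.
  pose B := [set b in blk (tau a) :\: porbit t a | E a (t b)].
  pose C := [set c in blk (tau a) :\: porbit t a | E c (t a)].
  apply: (@no_merge a B C).
  - by apply/subsetP=> v; rewrite inE => /andP[].
  - by apply/subsetP=> v; rewrite inE => /andP[].
  - by move=> v; rewrite inE => /andP[].
  - by move=> v; rewrite inE => /andP[].
  - have : #|[set u in H (tau a) | E a u]| <= #|t @: (B :|: (blk (tau a) :&: porbit t a))|.
      apply/subset_leq_card/subsetP=> u; rewrite inE -(eqP (tH _)).
      case/andP=> /imsetP[v bv ->] Eav; apply: imset_f.
      by rewrite !inE in bv *; rewrite bv Eav !andbT; case: (v \in _).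
    rewrite card_imset; last exact: perm_inj.
    have [+ _] := leq_card_setU B (blk (tau a) :&: porbit t a).
    by have := headdeg a; lia.
  - have : #|[set u in blk (tau a) | E u (t a)]| <= #|C :|: (blk (tau a) :&: porbit t a)|.
      apply/subset_leq_card/subsetP=> v; rewrite !inE => /andP[-> ->].
      by rewrite !andbT; case: (v \in _).
    have [+ _] := leq_card_setU C (blk (tau a) :&: porbit t a).
    by have := indeg (E_sub (tE a)); lia.
(* Two cycles meeting one block each have more than [h >= 8 * e * K] nodes there. All but fewer than
   [2 * e] nodes [z] of the first have a fraction [1/K] of the second as possible heads and as
   possible tails, hence more than [8 * e] of each, and a merge is possible at such a [z]. *)
have same_blk a b : tau a = tau b -> a \in porbit t b.
  move=> Tab; rewrite porbit_sym; apply/negPn/negP=> nab.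
  have dab v : v \in porbit t a -> v \notin porbit t b.
    move=> va; apply: contra nab => vb.
    by rewrite -eq_porbit_mem -(eqP (_ : porbit t v == porbit t b)) ?eq_porbit_mem.
  pose Z := blk (tau a) :&: porbit t a; pose Y := blk (tau b) :&: porbit t b.
  have hZ : h < #|Z| := many a; have hY : h < #|Y| := many b.
  have ZE v : v \in Z -> tau v = tau a by rewrite !inE => /andP[/eqP].
  have YE v : v \in Y -> tau v = tau a by rewrite !inE => /andP[/eqP-> _].
  pose bad1 := [set z in Z | K * #|[set y in Y | E z (t y)]| < #|Y|].
  pose bad2 := [set z in Z | K * #|[set y in Y | E y (t z)]| < #|Y|].
  have tI : injective t by apply: perm_inj.
  have lt1 : #|bad1| < e.
    rewrite ltnNge; apply/negP=> le1.
    have [||z] := @dense_out bad1 (t @: Y) _ le1.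
    - move=> z _ + /imsetP[y Yy ->]; rewrite inE => /andP[/ZE-> _].
      by rewrite -(YE _ Yy); apply: E_sub.
    - by rewrite card_imset //; lia.
    rewrite inE card_imset // => /andP[_]; rewrite ltnNge => /negP nle le'.
    apply: nle; apply: leq_trans le' _; rewrite leq_mul2l; apply/orP; right.
    rewrite -[leqRHS](card_imset _ tI); apply/subset_leq_card/subsetP=> u.
    by rewrite inE => /andP[/imsetP[y Yy ->] Ezy]; apply: imset_f; rewrite inE Yy.
  have lt2 : #|bad2| < e.
    rewrite ltnNge; apply/negP=> le2.
    have [|||z] := @dense_in Y (t @: bad2).
    - move=> y _ Yy /imsetP[z + ->]; rewrite inE => /andP[/ZE Tz _].
      by rewrite (YE _ Yy) -Tz; apply: E_sub.
    - by lia.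
    - by rewrite card_imset.
    case/imsetP=> z' + ->; rewrite inE => /andP[_]; rewrite ltnNge => /negP nle le'.
    by apply: nle.
  have [E0|[z]] := set_0Vmem (Z :\: (bad1 :|: bad2)).
    have := leq_card_setU bad1 bad2; case=> + _.
    by move: E0 => /eqP; rewrite setD_eq0 => /subset_leq_card; lia.
  rewrite in_setD in_setU => /andP[+ Zz].
  rewrite [z \in bad1]inE [z \in bad2]inE Zz /= negb_or -!leqNgt.
  case/andP=> leB leC.
  have za : z \in porbit t a by move: Zz; rewrite !inE => /andP[].
  have Ez : porbit t z = porbit t a by apply/eqP; rewrite eq_porbit_mem.
  have sY : Y \subset blk (tau z) :\: porbit t z.
    apply/subsetP=> y Yy; rewrite !inE Ez (YE _ Yy) (ZE _ Zz) eqxx andbT.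
    by apply/negP=> /dab; move: Yy; rewrite !inE => /andP[_ ->].
  apply: (@no_merge z [set y in Y | E z (t y)] [set y in Y | E y (t z)]).
  - by apply: subset_trans sY; apply/subsetP=> y; rewrite inE => /andP[].
  - by apply: subset_trans sY; apply/subsetP=> y; rewrite inE => /andP[].
  - by move=> y; rewrite inE => /andP[].
  - by move=> y; rewrite inE => /andP[].
  - rewrite leqNgt; apply/negP=> lt8; have := leq_mul (leqnn K) lt8; nia.
  - rewrite leqNgt; apply/negP=> lt8; have := leq_mul (leqnn K) lt8; nia.
have trans u v w : u \in porbit t v -> v \in porbit t w -> u \in porbit t w.
  by rewrite !porbit_fconnect => uv vw; apply: connect_trans vw uv.
move=> u v; have /connectP[p] := S_conn (tau v) (tau u).
elim: p v => [|j p IHp] v /= => [_ E0|/andP[Svj pS] lastE].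
  exact: same_blk.
(* The cycle through a block enters every successor block, because the heads [H] of that block
   contain a node of it; so the cycles follow the walks of the skeleton. *)
have [w Hw Tw] := heads Svj; move: Hw; rewrite -(eqP (tH _)) => /imsetP[v' bv' wE].
have Tv' : tau v' = tau v by move: bv'; rewrite !inE => /eqP.
apply: (trans _ w); first by apply: IHp; rewrite Tw.
rewrite wE; apply: sx; exact: same_blk.
Qed.
End SingleOrbit.

(** * Spanning cycle structures in quasirandom block digraphs *)

Section BlockDigraph.
Variables (V T : finType) (f : V -> T * option T) (S : rel T) (E : rel V).
Variables (e d K : nat).
Implicit Types (A B : {set V}).
Notation tau := (fun v => (f v).1).

(** The second component of [f] is the mark. Out-degrees are required into each marked part
    separately, since the reserved parts must be reachable; in-degrees are required from whole
    blocks. *)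
Record quasirandom : Prop := Quasirandom {
  qr_sub : forall u v, E u v -> S (f u).1 (f v).1;
  qr_dense_out : forall A B,
    {in A & B, forall a b, S (f a).1 (f b).1} -> e <= #|A| -> e <= #|B| ->
    exists2 a, a \in A & #|B| <= K * #|[set b in B | E a b]|;
  qr_dense_in : forall A B,
    {in A & B, forall a b, S (f a).1 (f b).1} -> e <= #|A| -> e <= #|B| ->
    exists2 b, b \in B & #|A| <= K * #|[set a in A | E a b]|;
  qr_outdeg : forall v j o, S (f v).1 j ->
    d <= #|[set u in f @^-1: [set (j, o)] | E v u]|;
  qr_indeg : forall v i, S i (f v).1 ->
    d <= #|[set u in tau @^-1: [set i] | E u v]|
}.

Hypothesis qr : quasirandom.
Hypotheses (e_gt0 : 0 < e).

Lemma qr_edge A B :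
  {in A & B, forall a b, S (f a).1 (f b).1} -> e <= #|A| -> e <= #|B| ->
  exists a b, [/\ a \in A, b \in B & E a b].
Proof.
move=> AB leA leB; have [a Aa] := qr_dense_out qr AB leA leB.
have [->|[b]] := set_0Vmem [set b in B | E a b]; first by rewrite cards0; lia.
by rewrite inE => /andP[Bb Eab] _; exists a, b.
Qed.

Lemma quasirandom_cycle_cover :
  (forall I : {set T}, targets S I = I \/
    #|tau @^-1: I| + (2 * #|T|) * e <= #|tau @^-1: targets S I|) ->
  (2 * #|T|) * e < d ->
  exists s : {perm V}, forall v, E v (s v).
Proof.
move=> gap lt_d; have TT : #|T| + #|T| = 2 * #|T| by rewrite mul2n addnn.
have [|s sP] := @hall V (compat_edge tau tau S E); last first.
  by exists s => v; have /andP[] := sP v.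
move=> A; apply: (@block_hall_card _ _ _ tau tau S E e d (2 * #|T| * e)).
- exact: qr_edge.
- move=> v j Sj; apply: leq_trans (qr_outdeg qr None Sj) _.
  apply/subset_leq_card/subsetP=> u; rewrite !inE.
  by case/andP=> /eqP-> ->; rewrite /= eqxx.
- exact: qr_indeg.
- by move=> I; case: (gap I) => [->|]; [left|right].
- by rewrite TT.
- by rewrite TT.
Qed.

(** In the gap hypothesis only unmarked targets are counted, because a reserved node may refuse most
    of the blocks that point to it. *)
Lemma quasirandom_hamilton :
  0 < K -> (forall i, exists v, (f v).1 = i) ->
  (forall i j, connect S i j) -> (forall j, exists i, S i j) ->
  (forall i, exists j, S i j) ->
  (forall I : {set T}, I != set0 -> I != setT ->
     #|tau @^-1: I| + (#|T| * #|T|.+2) * e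
       <= #|f @^-1: [set jo | (jo.1 \in targets S I) && (jo.2 == None)]|) ->
  #|T| * #|T|.+2 * e < d -> 8 * e * K.+1 <= d ->
  exists s : {perm V}, (forall v, E v (s v)) /\ forall u v, u \in porbit s v.
Proof.
move=> K_gt0 tau_surj S_conn S_in S_out gap lt_d le_d.
have TF : #|T| + #|{: T * option T}| = #|T| * #|T|.+2.
  by rewrite card_prod card_option !mulnS.
(* Nodes of type [(j, Some i)] are reserved: they are matched from block [i]
   only (unless [i] has no arc to [j]). *)
pose S' i (jo : T * option T) := S i jo.1 &&
  (if jo.2 is Some i' then (i == i') || ~~ S i' jo.1 else true).
have [|s sP] := @hall V (compat_edge tau f S' E).
  move=> A; apply: (@block_hall_card _ _ _ tau f S' E e d (#|T| * #|T|.+2 * e)).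
  - by move=> B C BC; apply: qr_edge => b c Bb Cc; have /andP[] := BC b c Bb Cc.
  - by move=> v [j o] /andP[Sj _]; apply: (qr_outdeg qr).
  - by move=> v i /andP[Si _]; apply: (qr_indeg qr).
    - move=> I; have [->|I0] := eqVneq I set0.
      left; rewrite preimset0 cards0; apply/esym/eqP; rewrite cards_eq0; apply/eqP/setP=> v.
      rewrite [v \in set0]inE [LHS]inE; apply/negP=> /targetsP[i].
      by rewrite inE.
    have [->|IT] := eqVneq I setT.
      (* For the full set of blocks there is no slack, so equality is needed: every node, reserved
         or not, accepts some block. *)
      left; apply: eq_card => v; rewrite [LHS]inE [RHS]inE in_setT.
      apply/esym/targetsP; case: (f v) => j [i|] /=.
        have [i' Si'] := S_in j; rewrite /S' /=.
        have [Sij|nSij] := boolP (S i j); first by exists i; rewrite // Sij eqxx.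
        by exists i'; rewrite // Si' orbT.
      by have [i Sij] := S_in j; exists i; rewrite // /S' Sij.
    right; apply: leq_trans (gap I I0 IT) _; apply: subset_leq_card.
    apply: preimsetS; apply/subsetP=> -[j o]; rewrite inE /= => /andP[+ /eqP->].
    by move=> /targetsP[i Ii Sij]; apply/targetsP; exists i; rewrite // /S' Sij.
  - by rewrite TF.
  - by rewrite TF.
(* Whatever the matching is, [H i] contains all nodes reserved for [i]. These supply both the head
   degrees and a head in each successor block of [i]. *)
pose H i := s @: (tau @^-1: [set i]).
have reserved i j u : S i j -> f u = (j, Some i) -> u \in H i.
  move=> Sij fu; apply/imsetP; exists ((s^-1)%g u); last by rewrite permKV.
  have /andP[_] := sP ((s^-1)%g u); rewrite permKV fu /S' /= Sij orbF.
  by case/andP=> _ /eqP Ei; rewrite !inE Ei.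
apply: (@single_orbit _ _ tau S E H e d d (8 * e * K) K) _ => //.
- exact: (qr_sub qr).
- exact: (qr_dense_out qr).
- exact: (qr_dense_in qr).
- exact: (qr_indeg qr).
- move=> v; have [j Sj] := S_out (f v).1.
  apply: leq_trans (qr_outdeg qr (Some (f v).1) Sj) _.
  apply/subset_leq_card/subsetP=> u; rewrite !inE => /andP[/eqP fu ->].
  by rewrite (reserved _ _ _ Sj fu).
- move=> i j Sij; have [v vi] := tau_surj i; rewrite -vi in Sij *.
  have := qr_outdeg qr (Some (f v).1) Sij.
  have [->|[u]] := set_0Vmem [set u in f @^-1: [set (j, Some (f v).1)] | E v u].
    by rewrite cards0; lia.
  rewrite !inE => /andP[/eqP fu _] _; exists u; last by rewrite fu.
  exact: reserved fu.
- by rewrite mulnS in le_d; lia.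
- by rewrite mulnS in le_d; nia.
- by nia.
- by move=> v; have /andP[] := sP v.
Qed.
End BlockDigraph.

(** * Cycle covers and closed walks *)

Section CoverOfPerm.
Variables (V : finType) (E : rel V) (s : {perm V}).
Hypothesis sE : forall v, E v (s v).

Lemma orbit_dicycle v : dicycle E (orbit s v).
Proof.
apply/and3P; split; rewrite ?orbit_uniq //.
  by apply/eqP=> E0; have := in_orbit s v; rewrite E0.
by apply: sub_cycle (cycle_orbit (@perm_inj _ s) v) => x y /eqP <-.
Qed.

Lemma perm_cycle_cover : has_cycle_cover E.
Proof.
have symc := fconnect_sym (@perm_inj _ s).
exists [seq orbit s v | v <- enum (froots s)]; split.
- by move=> c /mapP[v _ ->]; apply: orbit_dicycle.
- have -> : flatten [seq orbit s v | v <- enum (froots s)] =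
     [seq u | v <- enum (froots s), u <- orbit s v].
    by congr flatten; apply: eq_map => v; rewrite map_id.
  apply: allpairs_uniq_dep => [|v _|]; rewrite ?enum_uniq ?orbit_uniq //.
  move=> _ _ /allpairsPdep[v [x [+ vx ->]]] /allpairsPdep[w [y [+ wy ->]]] /= Exy.
  rewrite !mem_enum => /eqP rv /eqP rw; rewrite -{}Exy in wy *.
  suff -> : v = w by [].
  rewrite -rv -rw; apply/eqP; rewrite root_connect //.
  by move: vx wy; rewrite -!fconnect_orbit symc => xv wx; rewrite symc; apply: connect_trans wx xv.
- move=> v; apply/flattenP; exists (orbit s (froot s v)).
    by apply: map_f; rewrite mem_enum; apply: roots_root symc _.
  by rewrite -fconnect_orbit symc connect_root.
Qed.

Lemma perm_hamilton_cycle (v : V) : (forall u v, u \in porbit s v) ->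
  has_hamilton_cycle E.
Proof.
move=> one; exists (orbit s v); split; rewrite /= ?cats0 ?orbit_uniq //.
  by move=> c /[!inE] /eqP->; apply: orbit_dicycle.
by move=> u; rewrite -fconnect_orbit -porbit_fconnect.
Qed.
End CoverOfPerm.

Section Cycles.
Variables (T : finType) (S : rel T).
Local Open Scope ring_scope.

(** A closed walk that repeats a node splits there into two shorter closed walks; so, as a multiset
    of nodes, it is a union of directed cycles. This is how a cycle of the sample, projected to the
    skeleton, is compared with the columns of [incidence]. *)
Lemma closed_walk_ind (P : seq T -> Prop) :
    (forall c, dicycle S c -> P c) -> P [::] ->
    (forall c c', perm_eq c c' -> P c -> P c') ->
    (forall c c', P c -> P c' -> P (c ++ c')) ->
  forall c, path.cycle S c -> P c.
Proof.
move=> Pdi P0 Pperm Pcat c; have [k] := ubnP (size c).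
elim: k c => // k IHk c ltk Sc.
have [->//|c0] := eqVneq c [::].
have [Uc|/uniqPn] := boolP (uniq c); first by apply: Pdi; apply/and3P.
have [x0 c'] : T * seq T by case: c c0 {ltk Sc} => // x c' _; split.
move/(_ x0) => [i [j [ltij ltj Eij]]]; set x := nth x0 c i in Eij.
have lti := ltn_trans ltij ltj.
have Er : rot i c = x :: (drop i.+1 c ++ take i c) by rewrite /rot (drop_nth x0).
have xr : x \in drop i.+1 c ++ take i c.
  rewrite mem_cat; apply/orP; left; rewrite Eij -[j](subnKC ltij) -nth_drop.
  by rewrite mem_nth // size_drop ltn_sub2r // (leq_ltn_trans ltij).
have Ep : perm_eq (rot i c) c by apply/permPl/perm_rot.
have : path.cycle S (rot i c) by rewrite rot_cycle.
have := size_rot i c; move: Ep; rewrite {}Er; move: xr.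
case/splitPr=> p1 p2 Ep; rewrite /= size_cat /= => sz.
rewrite rcons_cat cat_path /= => /and3P[Sp1 Sx Sp2].
apply: Pperm Ep _; rewrite -cat_cons; apply: Pcat; apply: IHk => //.
- by rewrite /=; lia.
- by rewrite /= rcons_path Sp1.
- by rewrite /=; lia.
Qed.

Lemma closed_walk_sum (R : realDomainType) (q : T -> R) :
    (forall c, dicycle S c -> 0 <= \sum_(i <- c) q i) ->
  forall c, path.cycle S c -> 0 <= \sum_(i <- c) q i.
Proof.
move=> q0; apply: closed_walk_ind => //= [|c c' Ec|c c' c0 c'0].
- by rewrite big_nil.
- by rewrite (perm_big _ Ec).
- by rewrite big_cat addr_ge0.
Qed.

Lemma closed_walk_sum_eq0 (R : realDomainType) (q : T -> R) :
    (forall c, dicycle S c -> \sum_(i <- c) q i = 0) ->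
  forall c, path.cycle S c -> \sum_(i <- c) q i = 0.
Proof.
move=> q0; apply: closed_walk_ind => //= [|c c' Ec|c c' c0 c'0].
- by rewrite big_nil.
- by rewrite (perm_big _ Ec).
- by rewrite big_cat /= c0 c'0 addr0.
Qed.
End Cycles.

Section CoverSum.
Local Open Scope ring_scope.
Variables (V T : finType) (E : rel V) (S : rel T) (tau : V -> T).
Hypothesis ES : forall u v, E u v -> S (tau u) (tau v).

Lemma cover_sum (R : nmodType) (q : V -> R) cs : cycle_cover E cs ->
  \sum_v q v = \sum_(c <- cs) \sum_(v <- c) q v.
Proof.
case=> _ Uc cE; rewrite -big_flatten /=; apply/perm_big/uniq_perm => //.
  exact: index_enum_uniq.
by move=> v; rewrite cE mem_index_enum.
Qed.

Lemma cover_sum_ge0 (R : realDomainType) (q : T -> R) :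
    (forall c, dicycle S c -> 0 <= \sum_(i <- c) q i) -> has_cycle_cover E ->
  0 <= \sum_v q (tau v).
Proof.
move=> q0 [cs ccs]; rewrite (cover_sum _ ccs); case: ccs => /= dcs _ _.
rewrite big_seq; apply: sumr_ge0 => c /dcs/and3P[_ _ Ec].
rewrite -(big_map tau predT q); apply: closed_walk_sum q0 _ _; rewrite cycle_map.
by apply: sub_cycle Ec => u v /=; apply: ES.
Qed.

Lemma cover_sum_eq0 (R : realDomainType) (q : T -> R) :
    (forall c, dicycle S c -> \sum_(i <- c) q i = 0) -> has_cycle_cover E ->
  \sum_v q (tau v) = 0.
Proof.
move=> q0 [cs ccs]; rewrite (cover_sum _ ccs); case: ccs => /= dcs _ _.
rewrite big_seq big1 // => c /dcs/and3P[_ _ Ec].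
rewrite -(big_map tau predT q); apply: closed_walk_sum_eq0 q0 _ _; rewrite cycle_map.
by apply: sub_cycle Ec => u v /=; apply: ES.
Qed.

Lemma hamilton_connect u v : has_hamilton_cycle E -> connect S (tau u) (tau v).
Proof.
case=> c [dc _ cE]; have /and3P[_ _ Ec] := dc c (mem_head _ _).
have cu w : w \in c by have := cE w; rewrite /= cats0.
have [i c' Er] := rot_to (cu u).
have : path E u (rcons c' u).
  by rewrite -[path _ _ _]/(path.cycle E (u :: c')) -Er rot_cycle.
rewrite rcons_path => /andP[Ep _].
have Ev : v \in u :: c' by rewrite -Er mem_rot.
have : connect E u v by have := path_connect Ep Ev.
case/connectP=> p pE ->; apply/connectP; exists (map tau p); last by rewrite last_map.
by rewrite path_map; apply: sub_path pE => x y /=; apply: ES.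
Qed.
End CoverSum.

From mathcomp Require Import boolp reals.
Local Open Scope ring_scope.

(** * The finite sampling model *)

Section Model.
Variables (R : realType) (T : finType) (mu : T -> R) (w : T -> T -> R) (n : nat).
Hypotheses (mu_ge0 : forall t, 0 <= mu t) (mu_sum : \sum_t mu t = 1).
Hypothesis w_itv : forall t u, 0 <= w t u <= 1.
Implicit Types (f : {ffun 'I_n -> T}) (E F : {set 'I_n * 'I_n}).

Definition types_prob f : R := \prod_i mu (f i).

(* Loops have probability 0, so that all sets of pairs can be summed over. *)
Definition arc_prob f (a : 'I_n * 'I_n) : R :=
  if a.1 == a.2 then 0 else w (f a.1) (f a.2).

Definition arcs_prob f E : R :=
  \prod_a (if a \in E then arc_prob f a else 1 - arc_prob f a).

Definition types_pr (P : pred {ffun 'I_n -> T}) : R := \sum_(f | P f) types_prob f.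

Definition graph_pr f (P : pred {set 'I_n * 'I_n}) : R :=
  \sum_(E | P E) arcs_prob f E.

Definition sample_pr (P : {ffun 'I_n -> T} -> pred {set 'I_n * 'I_n}) : R :=
  \sum_f types_prob f * graph_pr f (P f).

Lemma arc_prob_itv f a : 0 <= arc_prob f a <= 1.
Proof. by rewrite /arc_prob; case: eqP => // _; rewrite lexx ler01. Qed.

Lemma types_prob_ge0 f : 0 <= types_prob f.
Proof. by apply: prodr_ge0. Qed.

Lemma arcs_prob_ge0 f E : 0 <= arcs_prob f E.
Proof.
apply: prodr_ge0 => a _; have /andP[a0 a1] := arc_prob_itv f a.
by case: ifP => _ //; rewrite subr_ge0.
Qed.

Lemma arcs_prob_edge f E u v : 0 < arcs_prob f E -> (u, v) \in E -> w (f u) (f v) != 0.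
Proof.
move=> E0 Euv; apply: contraTneq E0 => w0; rewrite -leNgt /arcs_prob.
by rewrite (bigD1 (u, v)) //= Euv /arc_prob /= w0 if_same mul0r.
Qed.

Lemma sum_types_prob (F : 'I_n -> T -> R) :
  \sum_(f : {ffun 'I_n -> T}) \prod_i F i (f i) = \prod_i \sum_t F i t.
Proof. by rewrite bigA_distr_bigA. Qed.

Lemma types_pr1 : types_pr predT = 1.
Proof.
rewrite /types_pr /types_prob (sum_types_prob (fun=> mu)).
by under eq_bigr do rewrite mu_sum; rewrite big1.
Qed.

Lemma graph_pr1 f : graph_pr f predT = 1.
Proof.
rewrite /graph_pr /arcs_prob -bigA_distr; apply: big1 => a _.
by rewrite /= addrCA subrr addr0.
Qed.

Lemma le_graph_pr f (P Q : pred {set 'I_n * 'I_n}) :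
  (forall E, P E -> 0 < arcs_prob f E -> Q E) -> graph_pr f P <= graph_pr f Q.
Proof.
move=> PQ; rewrite /graph_pr big_mkcond [leRHS]big_mkcond /=; apply: ler_sum => E _.
have := PQ E; rewrite lt_def arcs_prob_ge0 andbT.
case: ifP => [_ /(_ isT)|_ _]; last by case: ifP; rewrite ?arcs_prob_ge0.
by case: eqP => [->|_ /(_ isT) ->//]; case: ifP.
Qed.

Lemma graph_pr_ge0 f P : 0 <= graph_pr f P.
Proof. by apply: sumr_ge0 => E _; apply: arcs_prob_ge0. Qed.

Lemma graph_pr_le1 f P : graph_pr f P <= 1.
Proof. by rewrite -(graph_pr1 f); apply: le_graph_pr. Qed.

Lemma graph_pr_exists (I : finType) (A : pred I) f
    (P : I -> pred {set 'I_n * 'I_n}) :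
  graph_pr f (fun E => [exists i in A, P i E]) <= \sum_(i in A) graph_pr f (P i).
Proof.
rewrite /graph_pr; under [leRHS]eq_bigr do rewrite big_mkcond.
rewrite exchange_big /= big_mkcond /=; apply: ler_sum => E _.
case: ifP => [/exists_inP[i Ai PiE]|_]; last first.
  by apply: sumr_ge0 => i _; case: ifP => _; rewrite ?arcs_prob_ge0.
rewrite (bigD1 i) //= PiE lerDl; apply: sumr_ge0 => j _.
by case: ifP => _; rewrite ?arcs_prob_ge0.
Qed.

Lemma graph_prU f (P Q : pred {set 'I_n * 'I_n}) :
  graph_pr f (predU P Q) <= graph_pr f P + graph_pr f Q.
Proof.
rewrite /graph_pr !(big_mkcond _ (arcs_prob f)) -big_split /=; apply: ler_sum => E _.
by case: (P E); case: (Q E) => /=; rewrite ?addr0 ?add0r ?lerDl ?arcs_prob_ge0.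
Qed.

Lemma le_sample_pr P Q : (forall f, graph_pr f (P f) <= graph_pr f (Q f)) ->
  sample_pr P <= sample_pr Q.
Proof. by move=> PQ; apply: ler_sum => f _; rewrite ler_wpM2l ?types_prob_ge0. Qed.

Lemma sample_pr_ge0 P : 0 <= sample_pr P.
Proof.
by apply: sumr_ge0 => f _; rewrite mulr_ge0 ?types_prob_ge0 ?graph_pr_ge0.
Qed.

Lemma sample_pr1 : sample_pr (fun=> predT) = 1.
Proof.
rewrite -types_pr1; apply: eq_bigr => f _; by rewrite graph_pr1 mulr1.
Qed.

Lemma sample_pr_le1 P : sample_pr P <= 1.
Proof. by rewrite -sample_pr1; apply: le_sample_pr => f; apply: le_graph_pr. Qed.

Lemma sample_prC P : sample_pr P = 1 - sample_pr (fun f E => ~~ P f E).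
Proof.
apply/eqP; rewrite -subr_eq opprK -sample_pr1 -big_split /=; apply/eqP.
apply: eq_bigr => f _; rewrite -mulrDr; congr (_ * _).
by rewrite /graph_pr [RHS](bigID (P f)).
Qed.

Lemma sample_pr_bound P (bad : pred {ffun 'I_n -> T}) beta : 0 <= beta ->
    (forall f, ~~ bad f -> 0 < types_prob f -> graph_pr f (P f) <= beta) ->
  sample_pr P <= types_pr bad + beta.
Proof.
move=> b0 good; rewrite /sample_pr (bigID bad) /=; apply: lerD.
  by apply: ler_sum => f _; rewrite ler_piMr ?types_prob_ge0 ?graph_pr_le1.
rewrite -[leRHS]mul1r -types_pr1 /types_pr mulr_suml [leRHS](bigID bad) /=.
rewrite -[leLHS]add0r lerD //.
  by apply: sumr_ge0 => f _; rewrite mulr_ge0 ?types_prob_ge0.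
apply: ler_sum => f nbf; have := types_prob_ge0 f; rewrite le0r.
by case/predU1P=> [->|f0]; rewrite ?mul0r // ler_wpM2l ?good // ltW.
Qed.

Definition block_card f t : nat := #|[set v | f v == t]|.

Lemma block_card_sum f t : (block_card f t)%:R = \sum_v (f v == t)%:R :> R.
Proof.
rewrite /block_card -sum1_card natr_sum big_mkcond /=; apply: eq_bigr => v _.
by rewrite inE; case: (f v == t).
Qed.

Lemma sum_block_card f (q : T -> R) :
  \sum_v q (f v) = \sum_t q t * (block_card f t)%:R.
Proof.
under [RHS]eq_bigr do rewrite block_card_sum mulr_sumr.
rewrite exchange_big /=; apply: eq_bigr => v _.
rewrite (bigD1 (f v)) //= eqxx mulr1 big1 ?addr0 // => t.
by rewrite eq_sym => /negbTE->; rewrite mulr0.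
Qed.

(** The centred indicators are bounded by 1 and independent, so only the [n] diagonal terms of the
    squared sum survive. *)
Lemma types_variance t :
  \sum_f types_prob f * ((block_card f t)%:R - n%:R * mu t) ^+ 2 <= n%:R.
Proof.
pose y u : R := (u == t)%:R - mu t.
have mu1 : mu t <= 1.
  by rewrite -mu_sum (bigD1 t) //= lerDl sumr_ge0.
have Ey : \sum_u mu u * y u = 0.
  under eq_bigr do rewrite /y mulrBr.
  rewrite sumrB -mulr_suml mu_sum mul1r (bigD1 t) //= eqxx mulr1.
  by rewrite big1 ?addr0 ?subrr // => u /negbTE->; rewrite mulr0.
have y2 u : y u * y u <= 1.
  rewrite /y; have := mu_ge0 t; case: (u == t) => /=; nra.
have devE f : (block_card f t)%:R - n%:R * mu t = \sum_v y (f v).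
  rewrite /y sumrB -block_card_sum sumr_const card_ord mulr_natl //.
under eq_bigr do rewrite devE expr2 mulr_suml mulr_sumr.
under eq_bigr do under eq_bigr do rewrite mulr_sumr mulr_sumr.
rewrite exchange_big /=; under eq_bigr do rewrite exchange_big /=.
apply: (@le_trans _ _ (\sum_(v < n) 1)); last by rewrite sumr_const card_ord.
apply: ler_sum => v _; rewrite (bigD1 v) //= [X in _ + X]big1 ?addr0.
  rewrite -types_pr1 /types_pr; apply: ler_sum => f _.
  by rewrite ler_piMr ?types_prob_ge0.
move=> u uv.
(* Written as a product over all nodes, a cross term factors by distributivity, and its factor at
   [v] is the mean of [y], which is 0. *)
transitivity (\sum_(f : {ffun 'I_n -> T}) \prod_i (mu (f i) * ((if i == v then y (f i) else 1)
     * (if i == u then y (f i) else 1)))).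
  apply: eq_bigr => f _; rewrite !big_split /=; congr (_ * (_ * _)).
    by rewrite -big_mkcond big_pred1_eq.
  by rewrite -big_mkcond big_pred1_eq.
rewrite (sum_types_prob (fun i t => mu t * ((if i == v then y t else 1)
     * (if i == u then y t else 1)))).
rewrite (bigD1 v) //= eqxx [v == u]eq_sym (negbTE uv).
by under eq_bigr do rewrite mulr1; rewrite Ey mul0r.
Qed.

Lemma types_chebyshev t (h : R) : 0 < h -> (0 < n)%N ->
  types_pr (fun f => h * n%:R < `|(block_card f t)%:R - n%:R * mu t|)
    <= (h ^+ 2 * n%:R)^-1.
Proof.
move=> h0 n0; have hn0 : 0 < h * n%:R by rewrite mulr_gt0 ?ltr0n.
have -> : (h ^+ 2 * n%:R)^-1 = n%:R / (h * n%:R) ^+ 2.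
  by field; rewrite pnatr_eq0 -lt0n n0 gt_eqF.
rewrite ler_pdivlMr ?exprn_gt0 //; apply: le_trans (types_variance t).
rewrite /types_pr mulr_suml big_mkcond /=; apply: ler_sum => f _.
case: ifP => [lt_dev|_]; last by rewrite mulr_ge0 ?types_prob_ge0 ?sqr_ge0.
rewrite ler_wpM2l ?types_prob_ge0 // -[leRHS]real_normK ?num_real //.
by rewrite ler_sqr ?nnegrE ?normr_ge0 ?ltW.
Qed.
Lemma types_pr_dev (h : R) : 0 < h -> (0 < n)%N ->
  types_pr (fun f => [exists t, h * n%:R < `|(block_card f t)%:R - n%:R * mu t|])
    <= #|T|%:R / h ^+ 2 / n%:R.
Proof.
move=> h0 n0; apply: (@le_trans _ _ (\sum_(t : T) (h ^+ 2 * n%:R)^-1)); last first.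
  by rewrite sumr_const -[X in X <= _]mulr_natl invfM mulrA.
apply: le_trans (_ : \sum_t types_pr (fun f =>
  h * n%:R < `|(block_card f t)%:R - n%:R * mu t|) <= _); last first.
  by apply: ler_sum => t _; apply: types_chebyshev.
rewrite /types_pr; under [leRHS]eq_bigr do rewrite big_mkcond.
rewrite exchange_big /= big_mkcond /=; apply: ler_sum => f _.
have p0 := types_prob_ge0 f.
case: ifP => [/existsP[t tP]|_]; last by apply: sumr_ge0 => t _; case: ifP.
by rewrite (bigD1 t) //= tP lerDl sumr_ge0 // => u _; case: ifP.
Qed.
End Model.

Lemma prod_if_const (R : comPzSemiRingType) (I : finType) (A : {set I}) (x : R) :
  \prod_i (if i \in A then x else 1) = x ^+ #|A|.
Proof. by rewrite -big_mkcond /= prodr_const. Qed.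

(** * Lower tail of the number of arcs in a given set of pairs *)

Section Chernoff.
Variables (R : realType) (T : finType) (w : T -> T -> R) (n : nat).
Hypothesis w_itv : forall t u, 0 <= w t u <= 1.
Variables (w0 : R) (k : nat).
Hypotheses (w0_itv : 0 < w0 <= 1) (k_gt0 : (0 < k)%N).
Hypothesis k_half : (1 - w0 / 2) ^+ k <= 2^-1.
Implicit Types (f : {ffun 'I_n -> T}) (E F : {set 'I_n * 'I_n}).

(** Exponential moment with base [1/2]: each pair of [F] contributes a factor at most
    [r = 1 - w0 / 2], and the event costs [2 ^+ j] with [j] about [#|F| / (2 * k)]. As
    [r ^+ k <= 1/2], this cost consumes at most half of the factors [r]. *)
Lemma few_arcs_pr f F : {in F, forall a, w0 <= arc_prob w f a} ->
  graph_pr w f (fun E => 2 * k * #|E :&: F| <= #|F|)%N <= (1 - w0 / 2) ^+ #|F|./2.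
Proof.
move=> wF; have /andP[w0_gt0 w0_le1] := w0_itv.
set r := 1 - w0 / 2; have [r0 r1] : 0 < r /\ r <= 1 by rewrite /r; lra.
set N := #|F|; pose j := (N %/ (2 * k))%N.
have jN : (2 * k * j <= N)%N by rewrite mulnC leq_divM.
have expE E : (2^-1 : R) ^+ #|E :&: F| =
    \prod_a (if a \in E then if a \in F then 2^-1 else 1 else 1).
  by rewrite -prod_if_const; apply: eq_bigr => a _; rewrite inE; case: (a \in E).
have leE : graph_pr w f (fun E => 2 * k * #|E :&: F| <= N)%N <=
    2 ^+ j * \sum_E arcs_prob w f E * 2^-1 ^+ #|E :&: F|.
  rewrite mulr_sumr /graph_pr big_mkcond /=; apply: ler_sum => E _.
  have E0 := arcs_prob_ge0 w_itv f E.
  case: ifP => [leN|_]; last by rewrite !mulr_ge0 // exprn_ge0 ?invr_ge0.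
  rewrite mulrCA ler_peMr //.
  have le_j : (#|E :&: F| <= j)%N by rewrite leq_divRL ?muln_gt0 // mulnC.
  by rewrite -(subnK le_j) exprD -mulrA -exprMn mulfV ?pnatr_eq0 // expr1n mulr1 exprn_ege1 ?ler1n.
have sumE : \sum_E arcs_prob w f E * 2^-1 ^+ #|E :&: F| <= r ^+ N.
  have -> : \sum_E arcs_prob w f E * 2^-1 ^+ #|E :&: F| =
     \sum_(E in {set 'I_n * 'I_n}) \prod_a (if a \in E then
        arc_prob w f a * (if a \in F then 2^-1 else 1) else 1 - arc_prob w f a).
    apply: eq_bigr => E _; rewrite expE -big_split; apply: eq_bigr => a _ /=.
    by case: ifP; rewrite ?mulr1.
  rewrite -bigA_distr /= -prod_if_const; apply: ler_prod => a _.
  have /andP[a0 a1] := arc_prob_itv w_itv f a.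
  case: ifP => [Fa|_]; last by rewrite mulr1 addrCA subrr addr0 ler01 lexx.
  by have := wF a Fa; rewrite /r; nra.
have k2 : 2 ^+ j * r ^+ (k * j) <= 1.
  rewrite exprM -exprMn exprn_ile1 ?mulr_ge0 ?exprn_ge0 ?(ltW r0) //.
  by move: k_half; rewrite -/r; lra.
apply: le_trans leE _; apply: (@le_trans _ _ (2 ^+ j * r ^+ N)).
  by apply: ler_wpM2l => //; rewrite exprn_ge0.
have lekN : (k * j <= N)%N by move: jN; rewrite -mulnA; lia.
rewrite -(subnK lekN) addnC exprD mulrA; apply: le_trans (_ : 1 * r ^+ (N - k * j) <= _).
  by rewrite ler_wpM2r ?exprn_ge0 ?(ltW r0).
rewrite mul1r; apply: ler_wiXn2l; rewrite ?(ltW r0) // addnC subnK //.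
by move: jN; rewrite -mulnA; move: (k * j)%N => kj; lia.
Qed.

End Chernoff.

(** This turns exponential decay into harmonic decay, so that every error term of [good_sample_whp]
    can be put in the form [C / n]. *)
Lemma exprn_le_harmonic (R : realFieldType) (x : R) N : 0 <= x <= 1 ->
  (1 - x) ^+ N * (1 + N%:R * x) <= 1.
Proof.
case/andP=> x0 x1; elim: N => [|N IHN]; first by rewrite expr0 mul0r addr0 mulr1.
rewrite exprSr -mulrA; apply: le_trans IHN; rewrite ler_wpM2l ?exprn_ge0 //; first lra.
have : 0 <= N%:R :> R by []. rewrite -natr1; nra.
Qed.

(** * Anti-concentration of a sum of node potentials *)

Section Anticoncentration.
Variables (R : realType) (T : finType) (mu : T -> R) (n : nat).
Hypotheses (mu_gt0 : forall t, 0 < mu t) (mu_sum : \sum_t mu t = 1).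
Implicit Types f : {ffun 'I_n -> T}.

Definition retype (a b : T) (v : 'I_n) f : {ffun 'I_n -> T} :=
  [ffun i => if i == v then tperm a b (f i) else f i].

Lemma retypeK a b v : involutive (retype a b v).
Proof. by move=> f; apply/ffunP=> i; rewrite !ffunE; case: (i == v); rewrite ?tpermK. Qed.

Lemma retype_types_prob a b v f : f v = a ->
  types_prob mu (retype a b v f) * mu a = types_prob mu f * mu b.
Proof.
move=> fv; rewrite /types_prob (bigD1 v) //= [in RHS](bigD1 v) //= !ffunE eqxx fv tpermL.
rewrite (eq_bigr (fun i => mu (f i))); first by rewrite mulrAC [RHS]mulrAC [mu a * _]mulrC.
by move=> i /negbTE iv; rewrite ffunE iv.
Qed.

Variables (q : T -> R) (a b : T).
Hypothesis neq_q : q a != q b.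

(* The events [level k] are disjoint, and retyping one node from [a] to [b] leads
   from [level k] to [level k.+1]: consecutive levels have almost the same
   probability, so that level 0 has a small one. *)
Definition level (k : nat) f : bool := \sum_v q (f v) == k%:R * (q b - q a).

Lemma retype_level k v f : f v = a -> level k.+1 (retype a b v f) = level k f.
Proof.
move=> fv; rewrite /level (bigD1 v) //= [in RHS](bigD1 v) //= !ffunE eqxx fv tpermL.
have -> : \sum_(i | i != v) q (retype a b v f i) = \sum_(i | i != v) q (f i).
  by apply: eq_bigr => i /negbTE iv; rewrite ffunE iv.
by apply/eqP/eqP; rewrite -natr1 => H; lra.
Qed.

(** Double counting of pairs of a typing and a node [v], of type [a] on the left and [b] on the
    right; retyping [v] is the bijection. *)
Lemma level_exchange k :
  mu b * \sum_(f | level k f) types_prob mu f * (block_card f a)%:R =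
  mu a * \sum_(f | level k.+1 f) types_prob mu f * (block_card f b)%:R.
Proof.
have E j t : \sum_(f | level j f) types_prob mu f * (block_card f t)%:R =
    \sum_v \sum_(f | level j f && (f v == t)) types_prob mu f.
  under eq_bigr do rewrite block_card_sum mulr_sumr.
  rewrite exchange_big /=; apply: eq_bigr => v _; rewrite big_mkcondr /=.
  by apply: eq_bigr => f _; case: (f v == t); rewrite ?mulr1 ?mulr0.
rewrite !E !mulr_sumr; apply: eq_bigr => v _.
rewrite [in RHS](reindex_inj (can_inj (retypeK a b v))) /= !mulr_sumr.
apply: eq_big => [f|f /andP[_ /eqP fv]]; last first.
  by rewrite mulrC -(retype_types_prob b fv) mulrC.
rewrite ffunE eqxx (can2_eq (tpermK a b) (tpermK a b)) tpermR.
by case: eqP => [fv|]; rewrite ?andbF // retype_level.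
Qed.

(** In [level_exchange], replace each block size by its mean plus a deviation. The means leave
    [n * mu a * mu b] times the difference of the two probabilities, and the deviations cost at most
    [bound] each. *)
Lemma level_pr_diff k (h : R) : 0 < h -> (0 < n)%N ->
  types_pr mu (level k) - types_pr mu (level k.+1) <= 2 * (h + (h * n%:R)^-1) / (mu a * mu b).
Proof.
move=> h0 n0; have hn0 : 0 < h * n%:R by rewrite mulr_gt0 ?ltr0n.
have mu_ge0 t : 0 <= mu t by apply: ltW.
have mu_le1 t : mu t <= 1 by rewrite -mu_sum (bigD1 t) //= lerDl sumr_ge0.
pose dev t f : R := (block_card f t)%:R - n%:R * mu t.
pose bound := h * n%:R + h^-1.
(* A deviation [x] satisfies [|x| <= h * n + x^2 / (h * n)], according to whether it exceeds
   [h * n]; the variance bounds the mean of the second term by [1 / h]. *)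
have dev_le P t : `|\sum_(f | P f) types_prob mu f * dev t f| <= bound.
  apply: le_trans (ler_norm_sum _ _ _) _.
  apply: (@le_trans _ _ (\sum_f types_prob mu f * (h * n%:R + dev t f ^+ 2 / (h * n%:R)))).
    rewrite big_mkcond /=; apply: ler_sum => f _.
    have p0 := types_prob_ge0 mu_ge0 f.
    have t0 : 0 <= dev t f ^+ 2 / (h * n%:R) by rewrite divr_ge0 ?sqr_ge0 ?ltW.
    case: ifP => _; last by rewrite mulr_ge0 // addr_ge0 // ltW.
    rewrite normrM ger0_norm // ler_wpM2l //.
    have [le_h|/ltW lt_h] := leP `|dev t f| (h * n%:R).
      by rewrite (le_trans le_h) // lerDl.
    apply: (@le_trans _ _ (dev t f ^+ 2 / (h * n%:R))); last by rewrite lerDr ltW.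
    rewrite ler_pdivlMr //.
    by rewrite -[dev t f ^+ 2]real_normK ?num_real // expr2 ler_wpM2l.
  under eq_bigr do rewrite mulrDr [_ * (_ / _)]mulrA.
  rewrite big_split /= -!mulr_suml -[X in X * _]/(types_pr mu predT) types_pr1 // mul1r.
  rewrite lerD2l ler_pdivrMr // /bound mulrA mulVf ?gt_eqF // mul1r.
  exact: types_variance.
have split_dev P t : \sum_(f | P f) types_prob mu f * (block_card f t)%:R =
    n%:R * mu t * types_pr mu P + \sum_(f | P f) types_prob mu f * dev t f.
  rewrite mulr_sumr -big_split /=; apply: eq_bigr => f _; rewrite /dev; ring.
have := level_exchange k; rewrite !split_dev.
have := dev_le (level k) a; have := dev_le (level k.+1) b.
move: (\sum_(f | _) _) (\sum_(f | _) _) => X Y; rewrite !ler_norml.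
move=> /andP[X1 X2] /andP[Y1 Y2] E.
have n0' : 0 < n%:R :> R by rewrite ltr0n.
have -> : 2 * (h + (h * n%:R)^-1) / (mu a * mu b) = 2 * bound / (n%:R * mu a * mu b).
  by rewrite /bound; field; rewrite !gt_eqF.
rewrite ler_pdivlMr ?mulr_gt0 //.
have bound0 : 0 <= bound by rewrite addr_ge0 ?invr_ge0 ?(ltW hn0) ?(ltW h0).
have a1 := mu_le1 a; have b1 := mu_le1 b; have a0 := mu_gt0 a; have b0 := mu_gt0 b.
have XY : mu a * Y - mu b * X <= 2 * bound by nra.
move: E; set p1 := types_pr _ _; set p2 := types_pr _ _.
by move: bound XY {X1 X2 Y1 Y2 bound0 dev_le} => bnd XY E; lra.
Qed.

(** The first [J] levels have total probability at most 1, and each is at most [J * dlt] less likely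
    than level 0; average over them. *)
Lemma level_pr J (h : R) : 0 < h -> (0 < n)%N -> (0 < J)%N ->
  types_pr mu (fun f => \sum_v q (f v) == 0) <=
    J%:R^-1 + J%:R * (2 * (h + (h * n%:R)^-1) / (mu a * mu b)).
Proof.
move=> h0 n0 J0; set dlt := 2 * _ / _.
have mu_ge0 t : 0 <= mu t by apply: ltW.
have dlt0 : 0 <= dlt.
  have hn0 : 0 < h * n%:R by rewrite mulr_gt0 ?ltr0n.
  rewrite /dlt divr_ge0 ?mulr_ge0 ?addr_ge0 ?invr_ge0 ?(ltW h0) ?(ltW hn0) //.
have -> : types_pr mu (fun f => \sum_v q (f v) == 0) = types_pr mu (level 0).
  by apply: eq_bigl => f; rewrite /level mul0r.
have lek k : types_pr mu (level 0) <= types_pr mu (level k) + k%:R * dlt.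
  elim: k => [|k IHk]; first by rewrite mul0r addr0.
  by have := level_pr_diff k h0 n0; rewrite -/dlt -natr1 mulrDl mul1r; lra.
have disj : \sum_(k < J) types_pr mu (level k) <= 1.
  rewrite -(types_pr1 n mu_sum) /types_pr (exchange_big_dep predT) //=; apply: ler_sum => f _.
  rewrite sumr_const -mulr_natl ler_piMl ?types_prob_ge0 // lern1.
  rewrite leqNgt; apply/negP=> /card_gt1P[k [l [/eqP Ek /eqP El]]].
  apply/negP; rewrite negbK; apply/eqP/val_inj/eqP; rewrite -(eqr_nat R) /=.
  apply/eqP/(@mulIf _ (q b - q a)); first by rewrite subr_eq0 eq_sym.
  by rewrite -Ek -El.
have : \sum_(k < J) types_pr mu (level 0) <= 1 + J%:R * (J%:R * dlt).
  apply: le_trans (_ : \sum_(k < J) (types_pr mu (level k) + J%:R * dlt) <= _).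
    apply: ler_sum => k _; apply: le_trans (lek k) _.
    by rewrite lerD2l ler_wpM2r // ler_nat ltnW.
  by rewrite big_split /= sumr_const card_ord -[(J%:R * dlt) *+ J]mulr_natl lerD2r.
rewrite sumr_const card_ord -[X in X <= _]mulr_natl -ler_pdivlMl ?ltr0n //.
by rewrite mulrDr mulr1 mulKf // pnatr_eq0 -lt0n.
Qed.

End Anticoncentration.

(** * Quasirandomness of samples *)

Section Bounds.
Variable R : realType.
Implicit Types x : R.

Lemma nat_upper_bound x : exists k, (0 < k)%N /\ x <= k%:R.
Proof.
exists (Num.bound `|x|).+1; split=> //; apply: le_trans (ler_norm x) _.
by rewrite -natr1 ler_wpDr //; apply/ltW/(archi_boundP (normr_ge0 x)).
Qed.

Lemma expr_small x eps : 0 < x <= 1 -> 0 < eps ->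
  exists k, (0 < k)%N /\ (1 - x) ^+ k <= eps.
Proof.
case/andP=> x0 x1 e0; have [k [k0 lek]] := nat_upper_bound (x * eps)^-1.
exists k; split=> //; have xk : 0 < 1 + k%:R * x by rewrite ltr_pwDl ?mulr_ge0 // ltW.
have lek1 : (1 - x) ^+ k * (1 + k%:R * x) <= 1.
  by rewrite exprn_le_harmonic // x1 ltW.
rewrite -(ler_pM2r xk); apply: le_trans lek1 _.
by move: lek; rewrite -div1r ler_pdivrMr ?mulr_gt0 // => lek; nra.
Qed.

Lemma positive_lower_bound (I : finType) (g : I -> R) : (forall i, 0 < g i) ->
  exists m, 0 < m <= 1 /\ forall i, m <= g i.
Proof.
move=> g0; pose s := \sum_i (g i)^-1; exists (1 + s)^-1.
have s0 : 0 <= s by apply: sumr_ge0 => i _; rewrite invr_ge0 ltW.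
have s1 : 0 < 1 + s by rewrite ltr_pwDl.
split=> [|i]; first by rewrite invr_gt0 s1 invf_le1 // lerDl.
rewrite -[g i]invrK lef_pV2 ?posrE ?invr_gt0 // /s (bigD1 i) //=.
rewrite addrCA lerDl addr_ge0 //; apply: sumr_ge0 => j _; rewrite invr_ge0 ltW //.
Qed.
End Bounds.

Section Rectangles.
Variable n : nat.
Implicit Types (A B : {set 'I_n}) (E : {set 'I_n * 'I_n}).

Definition rectangle A B : {set 'I_n * 'I_n} :=
  [set a | [&& a.1 \in A, a.2 \in B & a.1 != a.2]].

Lemma card_rectangleT E A B :
  (#|E :&: rectangle A B| <= #|[set (a.2, a.1) | a in E] :&: rectangle B A|)%N.
Proof.
have inj : injective (fun a : 'I_n * 'I_n => (a.2, a.1)) by move=> [a b] [c d] [-> ->].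
rewrite -[leqLHS](card_imset _ inj); apply/subset_leq_card/subsetP=> _ /imsetP[[a b] + ->].
rewrite !inE /= => /and4P[Eab Aa Bb ab]; rewrite Bb Aa eq_sym ab !andbT.
by apply/imsetP; exists (a, b).
Qed.

Lemma card_rectangle A B : (#|A| * #|B| <= #|rectangle A B| + #|A|)%N.
Proof.
rewrite -cardsX -(cardsID [set a | a.1 == a.2] (setX A B)) addnC leq_add //.
  by apply/subset_leq_card/subsetP=> -[a b]; rewrite !inE => /andP[-> /andP[-> ->]].
have inj : {in setX A B :&: [set a | a.1 == a.2] &, injective fst}.
  by move=> [a b] [c d]; rewrite !inE /= => /andP[_ /eqP->] /andP[_ /eqP->] ->.
rewrite -(card_in_imset inj); apply/subset_leq_card/subsetP=> a /imsetP[[c d]].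
by rewrite !inE /= => /andP[/andP[Ac _] _] ->.
Qed.

Lemma card_rectangle_r A B : (#|A| * #|B| <= #|rectangle A B| + #|B|)%N.
Proof.
rewrite mulnC; apply: leq_trans (card_rectangle B A) _; rewrite leq_add2r.
rewrite -[rectangle B A]setTI; apply: leq_trans (card_rectangleT _ _ _) _.
exact/subset_leq_card/subsetIr.
Qed.

Lemma card_rectangle_out E A B :
  (#|E :&: rectangle A B| <= \sum_(a in A) #|[set b in B | (a, b) \in E]|)%N.
Proof.
rewrite -sum1_card (eq_bigl (fun a => (a.1 \in A) && (a \in E :&: rectangle A B))); last first.
  by move=> [a b]; rewrite !inE /=; case: (a \in A); rewrite ?andbF.
rewrite (partition_big fst (mem A)) => [|a /andP[]//]; apply: leq_sum => a Aa.
rewrite sum1_card.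
have inj : {in [pred c : 'I_n * 'I_n |
    (c.1 \in A) && (c \in E :&: rectangle A B) & c.1 == a] &, injective snd}.
  by move=> [c1 c2] [d1 d2]; rewrite !inE /= => /andP[_ /eqP->] /andP[_ /eqP->] ->.
rewrite -(card_in_imset inj); apply/subset_leq_card/subsetP=> b /imsetP[[c1 c2]].
rewrite !inE /= => /andP[/andP[_ /andP[Ec /and3P[_ Bb _]]] /eqP ca] ->.
by rewrite -ca Bb Ec.
Qed.

Lemma card_rectangle_in E A B :
  (#|E :&: rectangle A B| <= \sum_(b in B) #|[set a in A | (a, b) \in E]|)%N.
Proof.
apply: leq_trans (card_rectangleT _ _ _) _; apply: leq_trans (card_rectangle_out _ _ _) _.
apply: leq_sum => b _; apply/subset_leq_card/subsetP=> a; rewrite !inE.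
by case/andP=> -> /imsetP[[c d] Ecd [-> ->]].
Qed.
End Rectangles.

Section Quasirandom.
Variables (R : realType) (T : finType).
Notation U := (T * option T)%type.
Variables (mu : U -> R) (w : T -> T -> R).
Hypotheses (mu_gt0 : forall t, 0 < mu t) (mu_sum : \sum_t mu t = 1).
Hypothesis w_itv : forall t u, 0 <= w t u <= 1.

Definition lifted_w (t u : U) : R := w t.1 u.1.
Definition support : rel T := fun i j => w i j != 0.

Lemma lifted_w_itv t u : 0 <= lifted_w t u <= 1.
Proof. exact: w_itv. Qed.

Definition few_arcs n (k : nat) (A B : {set 'I_n}) (E : {set 'I_n * 'I_n}) : bool :=
  (2 * k * #|E :&: rectangle A B| <= #|rectangle A B|)%N.

Definition compatible n (f : {ffun 'I_n -> U}) (A B : {set 'I_n}) : bool :=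
  [forall a in A, forall b in B, support (f a).1 (f b).1].

Definition large_pair n (f : {ffun 'I_n -> U}) e (AB : {set 'I_n} * {set 'I_n}) : bool :=
  [&& compatible f AB.1 AB.2, (e <= #|AB.1|)%N & (e <= #|AB.2|)%N].

Definition fiber n (f : {ffun 'I_n -> U}) (t : U) : {set 'I_n} := [set v | f v == t].

Definition out_pair n (f : {ffun 'I_n -> U}) (vt : 'I_n * U) : bool :=
  compatible f [set vt.1] (fiber f vt.2).

Definition in_pair n (f : {ffun 'I_n -> U}) (vt : 'I_n * U) : bool :=
  compatible f (fiber f vt.2) [set vt.1].

Definition deficient n (f : {ffun 'I_n -> U}) k e (E : {set 'I_n * 'I_n}) : bool :=
  [|| [exists AB in large_pair f e, few_arcs k AB.1 AB.2 E],
      [exists vt in out_pair f, few_arcs k [set vt.1] (fiber f vt.2) E]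
    | [exists vt in in_pair f, few_arcs k (fiber f vt.2) [set vt.1] E]].

Lemma few_arcs_arith (k x r p a : nat) :
  (4 * k * x <= p)%N -> (2 * a <= p)%N -> (r < 2 * k * x)%N -> (p <= r + a)%N -> False.
Proof. by rewrite -!mulnA; move: (k * x)%N; lia. Qed.

Lemma degree_arith (d k c r b x : nat) : (0 < k)%N -> (d * (2 * k) <= b)%N ->
  (b <= r + 1)%N -> (r < 2 * k * x)%N -> (x <= c)%N -> (d <= c)%N.
Proof.
move=> k0 le_b le_r lt_r /(leq_trans _); apply.
have : (d * (2 * k) <= 2 * k * x)%N by lia.
by rewrite mulnC leq_pmul2l ?muln_gt0.
Qed.

Lemma deficientP n (f : {ffun 'I_n -> U}) k e d E :
    0 < arcs_prob lifted_w f E -> (0 < k)%N -> (1 < e)%N ->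
    (forall t, d * (2 * k) <= #|fiber f t|)%N ->
  ~~ deficient f k e E -> quasirandom f support (edge_rel E) e d (4 * k).
Proof.
move=> E0 k0 e1 le_d; rewrite /deficient !negb_or => /and3P[nL nO nI].
have sub u v : edge_rel E u v -> support (f u).1 (f v).1.
  exact: arcs_prob_edge E0.
have large (A B : {set 'I_n}) : {in A & B, forall a b, support (f a).1 (f b).1} ->
    (e <= #|A|)%N -> (e <= #|B|)%N ->
    (#|rectangle A B| < 2 * k * #|E :&: rectangle A B|)%N.
  move=> AB leA leB; move: nL; rewrite negb_exists => /forallP/(_ (A, B)).
  rewrite unfold_in /large_pair /= leA leB !andbT negb_and -ltnNge => /orP[|//].
  by case/negP; apply/forall_inP=> a Aa; apply/forall_inP=> b Bb; apply: AB.
split=> // [A B AB leA leB|A B AB leA leB|v j o Svj|v i Siv].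
- have [/exists_inP[a Aa le_a]|] := boolP [exists a in A,
    (#|B| <= 4 * k * #|[set b in B | edge_rel E a b]|)%N]; first by exists a.
  rewrite negb_exists_in => /forall_inP ltA.
  have : (4 * k * #|E :&: rectangle A B| <= #|A| * #|B|)%N.
    apply: leq_trans (leq_mul (leqnn _) (card_rectangle_out E A B)) _.
    rewrite big_distrr -sum_nat_const; apply: leq_sum => a Aa.
    by apply: ltnW; rewrite ltnNge ltA.
  have : (2 * #|A| <= #|A| * #|B|)%N by rewrite mulnC leq_mul2l (leq_trans e1) ?orbT.
  by move=> leA2 le4; case: (few_arcs_arith le4 leA2 (large A B AB leA leB) (card_rectangle A B)).
- have [/exists_inP[b Bb le_b]|] := boolP [exists b in B,
    (#|A| <= 4 * k * #|[set a in A | edge_rel E a b]|)%N]; first by exists b.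
  rewrite negb_exists_in => /forall_inP ltB.
  have : (4 * k * #|E :&: rectangle A B| <= #|A| * #|B|)%N.
    apply: leq_trans (leq_mul (leqnn _) (card_rectangle_in E A B)) _.
    rewrite big_distrr /= [leqRHS]mulnC -sum_nat_const; apply: leq_sum => b Bb.
    by apply: ltnW; rewrite ltnNge ltB.
  have : (2 * #|A| <= #|A| * #|B|)%N by rewrite mulnC leq_mul2l (leq_trans e1) ?orbT.
  by move=> leA2 le4; case: (few_arcs_arith le4 leA2 (large A B AB leA leB) (card_rectangle A B)).
- move: nO; rewrite negb_exists => /forallP/(_ (v, (j, o))).
  rewrite negb_and unfold_in -ltnNge => /orP[/negP[]|].
    apply/forall_inP=> a /set1P-> ; apply/forall_inP=> u.
    by rewrite inE => /eqP->.
  move=> lt_r; apply: degree_arith k0 (le_d (j, o)) _ lt_r _.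
    by have := card_rectangle [set v] (fiber f (j, o)); rewrite cards1 mul1n.
  apply: leq_trans (card_rectangle_out E _ _) _; rewrite big_set1.
  by apply/subset_leq_card/subsetP=> u; rewrite !inE.
- move: nI; rewrite negb_exists => /forallP/(_ (v, (i, None))).
  rewrite negb_and unfold_in -ltnNge => /orP[/negP[]|].
    apply/forall_inP=> a; rewrite inE => /eqP->; apply/forall_inP=> u /set1P->.
    by [].
  move=> lt_r; apply: degree_arith k0 (le_d (i, None)) _ lt_r _.
    by have := card_rectangle_r (fiber f (i, None)) [set v]; rewrite cards1 muln1.
  apply: leq_trans (card_rectangle_in E _ _) _; rewrite big_set1.
  by apply/subset_leq_card/subsetP=> u; rewrite !inE => /andP[/eqP-> Euv]; rewrite eqxx.
Qed.

End Quasirandom.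

Lemma half_pred_ge (y m : nat) : (0 < y)%N -> (8 * y <= m)%N -> (2 * y <= m.-1./2)%N.
Proof. by lia. Qed.

Lemma ceil_le (n c y : nat) : (0 < y)%N -> (n < 8 * c * y.+1)%N -> (n <= 16 * c * y)%N.
Proof. by move=> y0; rewrite mulnS; nia. Qed.

Lemma pair_exponent_lt (L M n e : nat) : (2 * L * M + 4 <= e)%N ->
  (n < M * e.+1)%N -> (2 * (L * n) < e * e.-1)%N.
Proof.
move=> le_e lt_n; have : (L * n <= L * (M * e.+1))%N by rewrite leq_mul2l ltnW ?orbT.
by move: le_e; rewrite -mulnA mulnA; move: (L * M)%N (L * n)%N => a b; nia.
Qed.

Lemma harmonic_scale (R : realFieldType) (r x N z c : R) : 0 < x -> 0 <= c -> 0 <= r ->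
  N <= 16 * c * z -> r * (1 + z * x) <= 1 -> r * (x * N) <= 16 * c.
Proof.
move=> x0 c0 r0 leN ler.
have : r * x * N <= r * x * (16 * c * z).
  by apply: ler_wpM2l; rewrite // mulr_ge0 // ltW.
have : 16 * c * (r * (1 + z * x)) <= 16 * c * 1.
  by apply: ler_wpM2l => //; rewrite mulr_ge0.
have : 0 <= 16 * c * r by rewrite !mulr_ge0.
by lra.
Qed.

Lemma block_card_lower (R : realFieldType) (a b N m m0 h : R) :
  0 <= a -> 0 < N -> 2 <= a * m0 -> m0 <= m -> h <= m0 / 2 -> N * m - h * N <= b -> N <= a * b.
Proof.
move=> a0 N0 am0 lem leh leb.
have : N * (m0 / 2) <= b.
  have : N * m0 <= N * m by rewrite ler_wpM2l // ltW.
  have : h * N <= m0 / 2 * N by rewrite ler_wpM2r // ltW.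
  by lra.
move/(ler_wpM2l a0); apply: le_trans.
have : N * 2 <= N * (a * m0) by rewrite ler_wpM2l // ltW.
by lra.
Qed.

Section QuasirandomPr.
Variables (R : realType) (T : finType).
Notation U := (T * option T)%type.
Variables (mu : U -> R) (w : T -> T -> R).
Hypotheses (mu_gt0 : forall t, 0 < mu t) (mu_sum : \sum_t mu t = 1).
Hypothesis w_itv : forall t u, 0 <= w t u <= 1.

Section Deficient.
Variables (w0 : R) (k L n e b : nat) (f : {ffun 'I_n -> U}).
Hypotheses (w0_itv : 0 < w0 <= 1) (k_gt0 : (0 < k)%N).
Hypothesis w0_le : forall i j, support w i j -> w0 <= w i j.
Local Notation rho := (1 - w0 / 2).
Hypotheses (k_half : rho ^+ k <= 2^-1) (L_small : rho ^+ L <= 8^-1).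
Hypotheses (le_e : (2 * (L * n) < e * e.-1)%N) (le_b : forall t, (b <= #|fiber f t|)%N).

Let rho01 : 0 <= rho <= 1.
Proof. by move: w0_itv => /andP[]; lra. Qed.

Lemma compatible_few_pr (A B : {set 'I_n}) N : compatible w f A B ->
  (2 * N <= #|rectangle A B|)%N ->
  graph_pr (lifted_w w) f (few_arcs k A B) <= rho ^+ N.
Proof.
move=> AB leN; have /andP[r0 r1] := rho01.
apply: le_trans (few_arcs_pr (lifted_w_itv w_itv) w0_itv k_gt0 k_half _) _.
  move=> [a c]; rewrite inE /arc_prob /= => /and3P[Aa Bc /negbTE->].
  by apply: w0_le; move/forall_inP: AB => /(_ a Aa)/forall_inP/(_ c Bc).
apply: ler_wiXn2l => //; move: leN; move: #|rectangle A B| => r; lia.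
Qed.

Lemma deficient_pr :
  graph_pr (lifted_w w) f (deficient w f k e) <=
    2^-1 ^+ n + 2 * (n * #|{: U}|)%:R * rho ^+ b.-1./2.
Proof.
have /andP[r0 r1] := rho01; have lwi := lifted_w_itv w_itv.
have few_sum (P : pred ('I_n * U)) (g h : 'I_n * U -> {set 'I_n}) :
    (forall vt, P vt -> compatible w f (g vt) (h vt)) ->
    (forall vt, (b.-1 <= #|rectangle (g vt) (h vt)|)%N) ->
  \sum_(vt in P) graph_pr (lifted_w w) f (few_arcs k (g vt) (h vt)) <=
    (n * #|{: U}|)%:R * rho ^+ b.-1./2.
  move=> Pgh leb.
  have -> : (n * #|{: U}|)%N = #|{: 'I_n * U}| by rewrite [RHS]card_prod card_ord.
  rewrite mulr_natl -sumr_const big_mkcond /=; apply: ler_sum => vt _.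
  case: ifP => [Pvt|_]; last by rewrite exprn_ge0.
  apply: compatible_few_pr; first exact: Pgh.
  by apply: leq_trans (leb vt); lia.
apply: le_trans (graph_prU lwi _ _ _) _; apply: lerD.
  apply: le_trans (graph_pr_exists lwi _ _ _) _.
  apply: (@le_trans _ _ (\sum_(AB : {set 'I_n} * {set 'I_n}) (8^-1) ^+ n)).
    rewrite big_mkcond /=; apply: ler_sum => -[A B] _.
    case: ifP => [/and3P[AB leA leB]|_]; last by rewrite exprn_ge0 ?invr_ge0.
    apply: le_trans (compatible_few_pr (N := L * n) AB _) _.
      have := card_rectangle A B; have := leq_mul leA leB; move: leA leB le_e; rewrite /=.
      move: #|A| #|B| #|rectangle A B| => x y z leA leB le_e' lexy le_z.
      have : (x * e.-1 <= x * y.-1)%N by rewrite leq_mul2l; apply/orP; right; lia.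
      have : (e * e.-1 <= x * e.-1)%N by rewrite leq_mul2r leA orbT.
      have : (x * y = x * y.-1 + x)%N by rewrite -mulnSr prednK //; lia.
      by lia.
    by rewrite exprM; apply: lerXn2r; rewrite ?nnegrE ?exprn_ge0 ?invr_ge0.
  rewrite sumr_const card_prod -cardsT -powersetT card_powerset cardsT card_ord.
  rewrite -[X in X <= _]mulr_natl natrM natrX.
  by rewrite -!exprMn; have -> : 2%:R * 2%:R * 8^-1 = 2^-1 :> R by field.
have -> : forall x : R, 2 * (n * #|{: U}|)%:R * x = (n * #|{: U}|)%:R * x + (n * #|{: U}|)%:R * x.
  by move=> x; ring.
apply: le_trans (graph_prU lwi _ _ _) _; apply: lerD;
  apply: le_trans (graph_pr_exists lwi _ _ _) _; apply: few_sum => // vt.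
  have := card_rectangle [set vt.1] (fiber f vt.2); have := le_b vt.2.
  by rewrite cards1 mul1n /=; lia.
have := card_rectangle_r (fiber f vt.2) [set vt.1]; have := le_b vt.2.
by rewrite cards1 muln1 /=; lia.
Qed.
End Deficient.

Definition good_sample n K e d (h : R) (f : {ffun 'I_n -> U}) E : bool :=
  [forall t, `|#|fiber f t|%:R - n%:R * mu t| <= h * n%:R] &&
  `[< quasirandom f (support w) (edge_rel E) e d K >].

Lemma good_sample_whp : exists K D : nat, [/\ (0 < K)%N, (0 < D)%N &
  forall (M : nat) (h : R), (0 < M)%N -> 0 < h -> exists C : R, forall n, (0 < n)%N ->
    sample_pr mu (lifted_w w) (fun (f : {ffun 'I_n -> U}) E =>
      ~~ good_sample K (n %/ M) (n %/ D) h f E) <= C / n%:R :> R ].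
Proof.
have [w0 [w0_itv w0_le']] : exists w0 : R, 0 < w0 <= 1 /\ forall ij : T * T,
    w0 <= (if w ij.1 ij.2 == 0 then 1 else w ij.1 ij.2).
  apply: positive_lower_bound => ij; case: eqP => [_|/eqP w0]; first exact: ltr01.
  by rewrite lt_def w0; have /andP[] := w_itv ij.1 ij.2.
have w0_le i j : support w i j -> w0 <= w i j.
  by move=> Sij; have := w0_le' (i, j); rewrite /= (negbTE Sij).
have x_itv : 0 < w0 / 2 <= 1 by move: w0_itv => /andP[]; lra.
have [k [k0 k_half]] := @expr_small _ _ 2^-1 x_itv ltac:(lra).
have [L [L0 L_small]] := @expr_small _ _ 8^-1 x_itv ltac:(lra).
have [m0 [/andP[m0_gt0 m0_le1] m0_le]] := positive_lower_bound mu_gt0.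
have [c [c0 c_ge]] := nat_upper_bound (2 / m0).
exists (4 * k)%N, (c * (2 * k))%N; split; rewrite ?muln_gt0 ?c0 ?k0 //.
move=> M h M0 h0; pose h' := Num.min h (m0 / 2).
have h'0 : 0 < h' by rewrite /h' lt_min h0 divr_gt0.
pose n0 := (M * (2 * L * M + 4) + 8 * c)%N.
pose U0 : R := #|{: U}|%:R.
have x0 : 0 < w0 / 2 by case/andP: x_itv.
pose C1 := 2 * U0 * (16 * c%:R / (w0 / 2)) ^+ 2.
have mu_ge0 t : 0 <= mu t by apply: ltW.
have [B B0 dev_pr] : exists2 B : R, 0 <= B & forall n (r : R), 0 < r -> (0 < n)%N ->
    types_pr mu (fun f : {ffun 'I_n -> U} =>
      [exists t, r * n%:R < `|(block_card f t)%:R - n%:R * mu t|]) <= B / r ^+ 2 / n%:R.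
  by eexists; last exact: (fun n r r0 n0 => types_pr_dev mu_ge0 mu_sum r0 n0).
pose C2 := B / h' ^+ 2.
have U0_ge0 : 0 <= U0 by apply: ler0n.
have C1_ge0 : 0 <= C1.
  by apply: mulr_ge0; [apply: mulr_ge0|apply: sqr_ge0].
have C2_ge0 : 0 <= C2 by apply: divr_ge0 => //; apply: sqr_ge0.
exists (n0%:R + 2 + C1 + C2) => n n_gt0.
have n_gt0' : 0 < n%:R :> R by rewrite ltr0n.
have lwi := lifted_w_itv w_itv.
have [lt_n|le_n] := ltnP n n0.
  apply: le_trans (sample_pr_le1 mu_ge0 mu_sum lwi _) _.
  rewrite ler_pdivlMr // mul1r; have : n%:R <= n0%:R :> R by rewrite ler_nat ltnW.
  by lra.
pose bad (f : {ffun 'I_n -> U}) := [exists t, h' * n%:R < `|(block_card f t)%:R - n%:R * mu t|].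
have bad_pr : types_pr mu bad <= C2 / n%:R.
  exact: dev_pr.
pose beta : R := 2^-1 ^+ n + 2 * (n * #|{: U}|)%:R * (1 - w0 / 2) ^+ (n %/ c).-1./2.
have le_n' : (M * (2 * L * M + 4) <= n)%N /\ (8 * c <= n)%N.
  by split; apply: leq_trans le_n; rewrite ?leq_addr ?leq_addl.
have rho0 : 0 <= 1 - w0 / 2 by move: x_itv => /andP[]; lra.
have half_le : 2^-1 ^+ n <= 2 / n%:R :> R.
  have : (1 - 2^-1) ^+ n * (1 + n%:R * 2^-1) <= 1 :> R by apply: exprn_le_harmonic; lra.
  have -> : 1 - 2^-1 = 2^-1 :> R by lra.
  rewrite ler_pdivlMr // mulrDr mulr1 mulrA => H.
  have : 0 <= 2^-1 ^+ n :> R by rewrite exprn_ge0 ?invr_ge0.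
  by move: (2^-1 ^+ n) (n%:R) H => a b H a0; lra.
have few_le : (1 - w0 / 2) ^+ (n %/ c).-1./2 <= (16 * c%:R / (w0 / 2)) ^+ 2 / n%:R ^+ 2.
  pose y := (n %/ (8 * c))%N.
  have y0 : (0 < y)%N by rewrite divn_gt0 ?muln_gt0 ?c0 // le_n'.2.
  have le_y : (2 * y <= (n %/ c).-1./2)%N.
    have : (8 * y <= n %/ c)%N.
      by rewrite leq_divRL // mulnAC mulnC leq_divM.
    exact: half_pred_ge.
  have n_le : (n <= 16 * c * y)%N.
    by apply: ceil_le => //; rewrite mulnC ltn_ceil // muln_gt0 c0.
  apply: (@le_trans _ _ ((1 - w0 / 2) ^+ y ^+ 2)).
    rewrite -exprM mulnC; apply: ler_wiXn2l => //.
    by move: x_itv => /andP[]; lra.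
  rewrite -expr_div_n; apply: lerXn2r; rewrite ?nnegrE ?exprn_ge0 ?divr_ge0 ?mulr_ge0 //.
  - by case/andP: w0_itv => /ltW.
  have x_itv' : 0 <= w0 / 2 <= 1 by case/andP: x_itv => /ltW ->.
  have -> : 16 * c%:R / (w0 / 2) / n%:R = 16 * c%:R / (w0 / 2 * n%:R).
    by rewrite -mulrA -invfM.
  rewrite ler_pdivlMr; last exact: mulr_gt0.
  apply: (@harmonic_scale _ _ (w0 / 2) n%:R y%:R c%:R) => //.
  - by rewrite exprn_ge0.
  - by rewrite -!natrM ler_nat.
  - exact: exprn_le_harmonic.
have beta_le : beta <= (2 + C1) / n%:R.
  rewrite mulrDl /beta; apply: lerD => //.
  have -> : C1 / n%:R = 2 * (n * #|{: U}|)%:R * ((16 * c%:R / (w0 / 2)) ^+ 2 / n%:R ^+ 2).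
    by rewrite /C1 natrM -/U0; field; rewrite gt_eqF //= gt_eqF // ; case/andP: w0_itv.
  by rewrite ler_wpM2l // mulr_ge0.
apply: le_trans (sample_pr_bound mu_ge0 mu_sum lwi (bad := bad) (beta := beta) _ _) _.
- by rewrite /beta addr_ge0 ?mulr_ge0 ?exprn_ge0 ?invr_ge0.
- move=> f; rewrite negb_exists => /forallP nbad _.
  have dev t : `|#|fiber f t|%:R - n%:R * mu t| <= h' * n%:R.
    by have := nbad t; rewrite -leNgt.
  have le_fib t : (n %/ c <= #|fiber f t|)%N.
    have : n%:R <= c%:R * #|fiber f t|%:R :> R.
      apply: (block_card_lower (m := mu t) (m0 := m0) (h := h')) => //.
      + by rewrite -ler_pdivrMr.
      + by rewrite /h' ge_min lexx orbT.
      + by have := dev t; rewrite ler_norml => /andP[+ _]; lra.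
    rewrite -natrM ler_nat => le_cf; apply: (@leq_trans (c * #|fiber f t| %/ c)).
      exact: leq_div2r.
    by rewrite mulKn.
  have e_ge : (2 * L * M + 4 <= n %/ M)%N by rewrite leq_divRL // mulnC le_n'.1.
  apply: (@le_trans _ _ (graph_pr (lifted_w w) f (deficient w f k (n %/ M)))).
    apply: (le_graph_pr lwi) => E nG E0; apply: contraNT nG => nD; apply/andP; split.
      apply/forallP=> t; apply: le_trans (dev t) _; rewrite ler_wpM2r ?(ltW n_gt0') //.
      by rewrite /h' ge_min lexx.
    apply/asboolP/(deficientP E0 k0) => // [|t]; first by apply: leq_trans e_ge; rewrite addnC.
    apply: leq_trans (le_fib t); rewrite divnMA; exact: leq_divM.
  apply: (deficient_pr (L := L) w0_itv k0 w0_le k_half L_small _ le_fib).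
  by apply: (pair_exponent_lt e_ge); rewrite mulnC ltn_ceil.
- have n0n : 0 <= n0%:R / n%:R :> R by rewrite divr_ge0.
  by move: beta_le bad_pr; rewrite !mulrDl; lra.
Qed.
End QuasirandomPr.

From mathcomp Require Import all_classical all_reals all_analysis.
Import numFieldNormedType.Exports.
Local Open Scope classical_set_scope.
Local Open Scope ring_scope.

(** * The node-circulation cone and step partitions *)

Section Farkas.
Variables (R : realFieldType) (m : nat).
Implicit Types (x : 'cV[R]_m) (q : 'rV[R]_m).

Definition dot q x : R := (q *m x) 0 0.

Lemma dotDr q x y : dot q (x + y) = dot q x + dot q y.
Proof. by rewrite /dot mulmxDr mxE. Qed.

Lemma dotNr q x : dot q (- x) = - dot q x.
Proof. by rewrite /dot mulmxN mxE. Qed.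

Lemma dotZr q a x : dot q (a *: x) = a * dot q x.
Proof. by rewrite /dot -scalemxAr mxE. Qed.

Lemma dotDl q r x : dot (q + r) x = dot q x + dot r x.
Proof. by rewrite /dot mulmxDl mxE. Qed.

Lemma dotNl q x : dot (- q) x = - dot q x.
Proof. by rewrite /dot mulNmx mxE. Qed.

Lemma dotZl q a x : dot (a *: q) x = a * dot q x.
Proof. by rewrite /dot -scalemxAl mxE. Qed.

(* Bartl's induction on the number of generators: if dropping z_0 loses the
   conclusion, a witness q_0 allows to project everything along z_0. *)
Lemma farkas k (z : 'I_k -> 'cV[R]_m) x :
    (forall q, (forall i, 0 <= dot q (z i)) -> 0 <= dot q x) ->
  exists c : 'I_k -> R, (forall i, 0 <= c i) /\ x = \sum_i c i *: z i.
Proof.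
elim: k z x => [|k IHk] z x zx.
  exists (fun=> 0); split=> //; rewrite big_ord0; apply/colP=> i; rewrite mxE.
  apply/eqP; rewrite eq_le; apply/andP; split.
    have /(_ _)/wrap[] := zx (- delta_mx 0 i); first by case.
    by rewrite dotNl /dot -rowE mxE oppr_ge0.
  have /(_ _)/wrap[] := zx (delta_mx 0 i); first by case.
  by rewrite /dot -rowE mxE.
pose z0 := z ord0; pose z1 i := z (lift ord0 i).
have [z1x|/existsNP[q0 /not_implyP[q0z /negP]]] :=
  pselect (forall q, (forall i, 0 <= dot q (z1 i)) -> 0 <= dot q x).
  have [c [c0 xE]] := IHk z1 x z1x.
  exists (fun i => if unlift ord0 i is Some j then c j else 0); split=> [i|].
    by case: unliftP.
  rewrite big_ord_recl unlift_none scale0r add0r xE.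
  by apply: eq_bigr => i _; rewrite liftK.
rewrite -ltNge => q0x.
have q0z0 : dot q0 z0 < 0.
  rewrite ltNge; apply/negP=> q0z0; move: q0x; rewrite ltNge zx // => i.
  by case: (unliftP ord0 i) => [j|] ->; [apply: q0z | apply: q0z0].
set al := dot q0 z0 in q0z0; have al0 : al != 0 by rewrite lt_eqF.
pose proj y := y - (dot q0 y / al) *: z0.
have [|c [c0 xE]] := IHk (proj \o z1) (proj x).
  move=> q qz; pose q' := q - (dot q z0 / al) *: q0.
  have q'E y : dot q' y = dot q (proj y).
    by rewrite /q' /proj !dotDl !dotDr !dotNl !dotNr !dotZl !dotZr; field.
  rewrite -q'E; apply: zx => i; rewrite q'E; case: (unliftP ord0 i) => [j|] ->.
    exact: qz.
  by rewrite /proj -/z0 -/al divff // scale1r subrr /dot mulmx0 mxE.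
have {}xE : x = \sum_i c i *: z1 i +
    (dot q0 x / al - \sum_i c i * (dot q0 (z1 i) / al)) *: z0.
  have xp : x = proj x + (dot q0 x / al) *: z0 by rewrite subrK.
  rewrite {1}xp xE scalerBl [LHS]addrC.
  rewrite [X in _ = _ + X]addrC addrA [RHS]addrC; congr (_ + _).
  rewrite scaler_suml -sumrB; apply: eq_bigr => i _.
  by rewrite /proj /= scalerBr scalerA.
exists (fun i => if unlift ord0 i is Some j then c j
  else dot q0 x / al - \sum_i c i * (dot q0 (z1 i) / al)); split=> [i|].
  case: unliftP => // _; rewrite subr_ge0; apply: (@le_trans _ _ 0).
    rewrite -oppr_ge0 -sumrN; apply: sumr_ge0 => j _.
    by rewrite -mulrN mulr_ge0 // -mulrN mulr_ge0 ?q0z // oppr_ge0 invr_le0 ltW.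
  by rewrite -mulrNN mulr_ge0 // ?oppr_ge0 ?invr_le0 ltW.
rewrite big_ord_recl unlift_none addrC {1}xE; congr (_ + _).
by apply: eq_bigr => i _; rewrite liftK.
Qed.
End Farkas.

Section Dicycles.
Variables (V : finType) (e : rel V).

Lemma cycle_nodes_arcs (c : seq V) : cycle_nodes (cycle_arcs c) =i c.
Proof.
move=> v; apply/imsetP/idP => [[a /imsetP[u uc ->] ->]//|vc].
by exists (v, next c v) => //; apply: imset_f.
Qed.

Lemma mem_dicycles c : dicycle e c -> cycle_arcs c \in dicycles e.
Proof.
move=> dc; have szc : (size c <= #|V|)%N.
  by case/and3P: dc => _ uc _; rewrite -(card_uniqP uc) max_card.
by apply/imsetP; exists (Bseq szc); rewrite ?inE.
Qed.

Lemma dicyclesP C : C \in dicycles e -> exists2 c, dicycle e c & C = cycle_arcs c.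
Proof. by case/imsetP=> c; rewrite inE => dc ->; exists c. Qed.

Lemma sum_next (R : nmodType) (q : V -> R) c : uniq c ->
  \sum_(i <- c) q (next c i) = \sum_(i <- c) q i.
Proof.
move=> uc; rewrite -(big_map (next c) predT q); apply/perm_big/uniq_perm => //.
  by rewrite map_inj_uniq //; apply: can_inj (prev_next uc).
move=> v; apply/mapP/idP => [[u uc' ->]|vc]; first by rewrite mem_next.
by exists (prev c v); rewrite ?mem_prev // next_prev.
Qed.

End Dicycles.

Section Conditions.
Variables (R : realType) (W : R * R -> R) (s : seq R).
Notation S := (@skeleton R W s).
Notation Z := (@incidence R W s).
Implicit Types (q : 'I_(size s) -> R).

Definition potential q (c : seq 'I_(size s)) : R := \sum_(i <- c) q i.

Lemma row_incidence q c (j : 'I_#|dicycles S|) : dicycle S c ->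
  enum_val j = cycle_arcs c -> (\row_i q i *m Z) 0 j = potential q c.
Proof.
case/and3P=> _ uc _ jE; rewrite mxE /potential (big_uniq _ uc) [RHS]big_mkcond.
apply: eq_bigr => i _; rewrite !mxE jE cycle_nodes_arcs.
by case: (i \in c); rewrite ?mulr1 ?mulr0.
Qed.

Lemma incidence_ge0P q :
  (forall j, 0 <= (\row_i q i *m Z) 0 j) <-> (forall c, dicycle S c -> 0 <= potential q c).
Proof.
split=> [q0 c dc|q0 j].
  have Cc := mem_dicycles dc.
  by rewrite -(row_incidence q dc (enum_rankK_in Cc Cc)).
have [c dc jE] := dicyclesP (enum_valP j).
by rewrite (row_incidence q dc jE) q0.
Qed.

Lemma incidence_eq0P q :
  \row_i q i *m Z = 0 <-> (forall c, dicycle S c -> potential q c = 0).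
Proof.
split=> [q0 c dc|q0].
  have Cc := mem_dicycles dc.
  by rewrite -(row_incidence q dc (enum_rankK_in Cc Cc)) q0 mxE.
apply/rowP=> j; have [c dc jE] := dicyclesP (enum_valP j).
by rewrite (row_incidence q dc jE) q0 // mxE.
Qed.

Lemma condition_AP : condition_A W s <->
  (forall q, (forall c, dicycle S c -> potential q c = 0) -> forall i, q i = 0).
Proof.
have -> : condition_A W s <-> row_free Z.
  rewrite /condition_A /corank /row_free; have := rank_leq_row Z.
  by move=> le; split=> [/eqP|/eqP->]; rewrite ?subnn // subn_eq0 eqn_leq le.
split=> [fZ q /incidence_eq0P q0 i|qZ].
  have /rowP/(_ i) : \row_i q i = 0 by apply: (row_free_inj fZ); rewrite q0 mul0mx.
  by rewrite !mxE.
rewrite -kermx_eq0; apply/eqP/row_matrixP=> k; rewrite row0.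
have /qZ q0 : forall c, dicycle S c -> potential (fun i => kermx Z k i) c = 0.
  apply/incidence_eq0P; rewrite -[RHS](_ : row k (kermx Z) *m Z = 0).
    by congr (_ *m _); apply/rowP=> i; rewrite [LHS]mxE [RHS]mxE.
  by rewrite -row_mul mulmx_ker row0.
by apply/rowP=> i; rewrite [LHS]mxE [RHS]mxE q0.
Qed.

Lemma dot_col (r : 'rV_(size s)) j : dot r (col j Z) = (r *m Z) 0 j.
Proof. by rewrite /dot !mxE; apply: eq_bigr => i _; rewrite [in LHS]mxE. Qed.

Definition weight q : R := \sum_i q i * concentration s i 0.

Lemma dot_concentration q : dot (\row_i q i) (concentration s) = weight q.
Proof. by rewrite /dot mxE; apply: eq_bigr => i _; rewrite mxE. Qed.

Lemma not_condition_B' : ~ condition_B' W s ->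
  exists2 q, (forall c, dicycle S c -> 0 <= potential q c) & weight q < 0.
Proof.
move=> nB; apply: contrapT => nq; apply: nB.
have [|c [c0 xE]] := @farkas R _ _ (fun j => col j Z) (concentration s).
  move=> q qZ; rewrite leNgt; apply/negP=> q0; apply: nq.
  have qE : \row_i q 0 i = q by apply/rowP=> i; rewrite mxE.
  exists (q 0); last by rewrite -dot_concentration qE.
  apply/incidence_ge0P => j; rewrite qE; have := qZ j.
  by rewrite dot_col.
exists (\col_j c j); split=> [j|]; first by rewrite mxE.
rewrite xE; apply/colP=> i; rewrite summxE mxE; apply: eq_bigr => j _.
by rewrite !mxE mulrC.
Qed.

Lemma condition_B_weight q : condition_B W s ->
  (forall c, dicycle S c -> 0 <= potential q c) ->
  0 <= weight q /\ (weight q = 0 -> forall c, dicycle S c -> potential q c = 0).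
Proof.
move=> [[c [c0 xE]] near_x] q0; have /incidence_ge0P qZ := q0.
have coneP y : circulation_cone W y -> 0 <= dot (\row_i q i) y.
  move=> [b [b0 ->]]; rewrite /dot mulmxA mxE; apply: sumr_ge0 => j _.
  by rewrite mulr_ge0.
split; first by rewrite -dot_concentration coneP //; exists c.
move=> w0 c' dc'; apply/eqP; rewrite eq_le q0 // andbT leNgt; apply/negP=> pos.
have Cc := mem_dicycles dc'; pose j := enum_rank_in Cc (cycle_arcs c').
pose z := col j Z.
have zE : dot (\row_i q i) z = potential q c'.
  by rewrite dot_col; apply: row_incidence (enum_rankK_in Cc Cc).
have [eps eps0 near_eps] : exists2 eps : R, 0 < eps &
    circulation_cone W (concentration s - eps *: z).
  have cvg : (concentration s - eps *: z @[eps --> (0 : R^o)] --> concentration s)%classic.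
    rewrite -[X in (_ --> X)%classic]subr0 -(scale0r z).
    by apply: cvgB; [apply: cvg_cst|apply: cvgZr_tmp; apply: cvg_id].
  have /nbhs_ballP[r /= r0 ball_r] := cvg _ near_x.
  exists (r / 2); first by rewrite divr_gt0.
  apply: ball_r.
    by rewrite /ball /= sub0r normrN gtr0_norm ?divr_gt0 // ltr_pdivrMr //
      mulr2n mulrDr mulr1 ltrDl.
  exists 2, (fun i => if i == ord0 then 1 + r / 2 else - (r / 2)),
    (fun i => if i == ord0 then concentration s else concentration s + z).
  split=> [i||]; rewrite ?big_ord_recl ?big_ord0 /=.
  - case: ifP => _; first by exists c.
    exists (c + delta_mx j 0); split=> [k|]; last by rewrite mulmxDr -xE -colE.
    by rewrite !mxE addr_ge0 // ler0n.
  - by rewrite addr0 addrK.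
  - by rewrite addr0 scalerDl scale1r scalerDr !scaleNr addrA addrK.
have := coneP _ near_eps; rewrite dotDr dotNr dotZr dot_concentration w0 zE.
by rewrite sub0r oppr_ge0 leNgt mulr_gt0.
Qed.
End Conditions.

Section Partition.
Variables (R : realType) (s : seq R).
Hypothesis ps : itv_partition 0 1 s.

Definition in_block (i : 'I_(size s)) (x : R) := sigma s i <= x < sigma s i.+1.

Lemma sigma0 : sigma s 0 = 0.
Proof. by []. Qed.

Lemma sigma_size : sigma s (size s) = 1.
Proof. by case: ps => _ /eqP <-; rewrite /sigma -last_nth. Qed.

Lemma size_partition_gt0 : (0 < size s)%N.
Proof.
rewrite lt0n; apply/eqP=> s0; have /eqP := sigma_size.
by rewrite s0 sigma0 eq_sym oner_eq0.
Qed.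

Lemma sigma_lt k : (k < size s)%N -> sigma s k < sigma s k.+1.
Proof. by case: ps => /(pathP 0) ps' _ /ps'. Qed.

Lemma sigma_le j k : (j <= k <= size s)%N -> sigma s j <= sigma s k.
Proof.
case/andP=> /subnK <-; elim: (k - j)%N => // n IHn lts.
by rewrite addSn; apply: le_trans (IHn (ltnW lts)) (ltW (sigma_lt lts)).
Qed.

Lemma sigma_itv k : (k <= size s)%N -> 0 <= sigma s k <= 1.
Proof. by move=> lek; rewrite -sigma0 -sigma_size !sigma_le ?lek ?leqnn. Qed.

Lemma in_block_sigma i : in_block i (sigma s i).
Proof. by rewrite /in_block lexx sigma_lt. Qed.

Lemma block_exists x : 0 <= x < 1 -> exists i, in_block i x.
Proof.
case/andP=> x0 x1; have ex : exists k, x < sigma s k.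
  by exists (size s); rewrite sigma_size.
case: (ex_minnP ex) => -[|k] ltx mink; first by rewrite sigma0 ltNge x0 in ltx.
have ltk : (k < size s)%N by apply: mink; rewrite sigma_size.
exists (Ordinal ltk); rewrite /in_block /= ltx andbT leNgt.
by apply/negP=> /mink; rewrite ltnn.
Qed.

Lemma in_block_inj i j x : in_block i x -> in_block j x -> i = j.
Proof.
have lt_absurd (k l : 'I_(size s)) : (k < l)%N -> in_block k x -> in_block l x -> False.
  move=> ltkl /andP[_ xk] /andP[lx _].
  have : sigma s k.+1 <= sigma s l by rewrite sigma_le // ltkl ltnW.
  by move/le_trans/(_ lx); rewrite leNgt xk.
move=> xi xj; apply: val_inj; case: (ltngtP i j) => // lt.
  by case: (lt_absurd _ _ lt).
by case: (lt_absurd _ _ lt).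
Qed.

Lemma in_block_itv i x : in_block i x -> 0 <= x < 1.
Proof.
case/andP=> sx xs; have /andP[s0 _] := sigma_itv (ltnW (ltn_ord i)).
have /andP[_ s1] := sigma_itv (ltn_ord i).
by rewrite (le_trans s0 sx) (lt_le_trans xs s1).
Qed.

Lemma block_fun : exists b : R -> 'I_(size s), forall i x, in_block i x -> b x = i.
Proof.
pose i0 := Ordinal size_partition_gt0.
exists (fun x => odflt i0 [pick i | in_block i x]) => i x xi.
by case: pickP => [j xj|/(_ i)]; [apply: in_block_inj xj xi|rewrite xi].
Qed.

Lemma concentration_gt0 i : 0 < concentration s i 0.
Proof. by rewrite mxE subr_gt0 sigma_lt. Qed.

Lemma sum_concentration : \sum_i concentration s i 0 = 1.
Proof.
under eq_bigr do rewrite mxE.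
rewrite -(big_mkord xpredT (fun i => sigma s i.+1 - sigma s i)) telescope_sumr //.
by rewrite sigma0 sigma_size subr0.
Qed.

Lemma rectE i j p : rect i j p <-> in_block i p.1 /\ in_block j p.2.
Proof. by rewrite /rect /in_block /=; split=> -[]; rewrite /= !in_itv. Qed.

End Partition.

Section Skeleton.
Variables (R : realType) (W : R * R -> R).

Lemma skeletonE s i j x y : partition_for W s -> in_block i x -> in_block j y ->
  @skeleton R W s i j = (W (x, y) != 0).
Proof.
move=> [ps Ws] xi yj; have rxy : rect i j (x, y) by apply/rectE.
by apply/asboolP/idP => [/(_ _ rxy)//|Wxy p rp]; rewrite (Ws _ _ _ _ rp rxy).
Qed.

Lemma condition_A_transfer s1 s2 : partition_for W s1 -> partition_for W s2 ->
  condition_A W s1 -> condition_A W s2.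
Proof.
move=> p1 p2 /condition_AP A1; apply/condition_AP => q q0 b.
have [b1 b1P] := block_fun p1.1; have [b2 b2P] := block_fun p2.1.
pose x := sigma s2 b; have xb : in_block b x := in_block_sigma p2.1 b.
have [a xa] := block_exists p1.1 (in_block_itv p2.1 xb).
pose pt i := if i == a then x else sigma s1 i.
have ptP i : in_block i (pt i).
  by rewrite /pt; case: eqP => [->//|_]; apply: in_block_sigma p1.1 i.
have pt2 i : in_block (b2 (pt i)) (pt i).
  have [j pj] := block_exists p2.1 (in_block_itv p1.1 (ptP i)).
  by rewrite (b2P _ _ pj).
have := A1 (q \o b2 \o pt) _ a; rewrite /= /pt eqxx (b2P _ _ xb); apply.
move=> c /and3P[_ _ Sc]; rewrite /potential -(big_map (b2 \o pt) predT q).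
apply: closed_walk_sum_eq0 q0 _ _; rewrite cycle_map.
apply: sub_cycle Sc => u v /=.
by rewrite (skeletonE p1 (ptP u) (ptP v)) (skeletonE p2 (pt2 u) (pt2 v)).
Qed.

Lemma condition_C_transfer s1 s2 : partition_for W s1 -> partition_for W s2 ->
  (1 < size s1)%N -> condition_C W s1 -> condition_C W s2.
Proof.
move=> p1 p2 s1_gt1 C1 u v.
have [b1 b1P] := block_fun p1.1; have [b2 b2P] := block_fun p2.1.
have b2in i x : in_block (s := s1) i x -> in_block (b2 x) x.
  move=> xi; have [j xj] := block_exists p2.1 (in_block_itv p1.1 xi).
  by rewrite (b2P _ _ xj).
pose x := sigma s2 u; have xu : in_block u x := in_block_sigma p2.1 u.
pose y := sigma s2 v; have yv : in_block v y := in_block_sigma p2.1 v.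
have [a xa] := block_exists p1.1 (in_block_itv p2.1 xu).
have [b yb] := block_exists p1.1 (in_block_itv p2.1 yv).
have walk p a' x' : in_block a' x' -> path (@skeleton R W s1) a' (rcons p b) ->
    connect (@skeleton R W s2) (b2 x') v.
  elim: p a' x' => [|d p IHp] a' x' xa' /=.
    rewrite andbT (skeletonE p1 xa' yb) => Wxy; apply: connect1.
    by rewrite (skeletonE p2 (b2in _ _ xa') yv).
  case/andP=> Sad Sp; have dd := in_block_sigma p1.1 d.
  apply: connect_trans (IHp d _ dd Sp); apply: connect1.
  by rewrite (skeletonE p2 (b2in _ _ xa') (b2in _ _ dd)) -(skeletonE p1 xa' dd).
have [d nda] : exists d, d != a.
  have : (1 < #|'I_(size s1)|)%N by rewrite card_ord.
  by rewrite (cardD1 a) inE add1n ltnS => /card_gt0P[d]; rewrite !inE andbT; exists d.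
have [p Sp lastp] : exists2 p, path (@skeleton R W s1) a p & b = last a p /\ p != [::].
  have /connectP[p1' Sp1 E1] := C1 a d; have /connectP[p2' Sp2 E2] := C1 d b.
  exists (p1' ++ p2'); first by rewrite cat_path Sp1 -E1.
  rewrite last_cat -E1; split=> //; apply: contraNneq nda.
  by case: p1' E1 {Sp1} => //= ->.
case: lastp; case/lastP: p Sp => // p b' Sp; rewrite last_rcons => E _.
by rewrite -(b2P _ _ xu); apply: walk xa _; rewrite E; apply: Sp.
Qed.

End Skeleton.

Section Balance.
Variables (R : realType) (W : R * R -> R) (s : seq R).
Hypotheses (pW : partition_for W s) (cA : condition_A W s) (cB : condition_B W s).
Notation S := (@skeleton R W s).
Notation mass I := (\sum_(i in I) concentration s i 0).

Lemma balance_gap (I : {set 'I_(size s)}) :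
  targets S I = I \/ mass I < mass (targets S I).
Proof.
pose q i : R := (i \in targets S I)%:R - (i \in I)%:R.
have qc c : dicycle S c -> 0 <= potential q c.
  case/and3P=> _ uc Sc; rewrite /potential /q sumrB subr_ge0.
  rewrite -[leRHS](sum_next _ uc) big_seq [leRHS]big_seq; apply: ler_sum => i ic.
  rewrite ler_nat; case: (boolP (i \in I)) => // Ii.
  have /targetsP -> // : exists2 k, k \in I & S k (next c i).
  by exists i => //; apply: next_cycle.
have wE : weight q = mass (targets S I) - mass I.
  rewrite /weight [X in _ = X - _]big_mkcond [X in _ = _ - X]big_mkcond /= -sumrB.
  apply: eq_bigr => i _; rewrite mulrBl.
  by do 2!case: (_ \in _); rewrite ?mul1r ?mul0r.
have [w0 wq0] := condition_B_weight cB qc.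
have [w_eq0|w_neq0] := eqVneq (weight q) 0; last first.
  by right; rewrite -subr_gt0 -wE lt_def w_neq0.
left; have /condition_AP qA := cA; have q0 := qA q (wq0 w_eq0).
apply/setP=> i; have /eqP := q0 i; rewrite subr_eq0 eqr_nat.
by do 2!case: (i \in _).
Qed.

Lemma balance_out i : exists j, S i j.
Proof.
case: (balance_gap [set i]%SET) => [E|].
  have : i \in targets S [set i]%SET by rewrite E set11.
  by case/targetsP=> k /set1P-> ?; exists i.
have [->|[j /targetsP[k /set1P-> ?]]] := set_0Vmem (targets S [set i]%SET).
  rewrite big_set0 big_set1 ltNge; move/negP; case.
  exact: ltW (concentration_gt0 pW.1 i).
by exists j.
Qed.

Lemma balance_in j : exists i, S i j.
Proof.
case: (balance_gap finset.setT) => [E|].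
  have : j \in targets S finset.setT by rewrite E inE.
  by case/targetsP=> k _ ?; exists k.
rewrite ltNge; case/negP; rewrite [leRHS](bigID [in targets S finset.setT]) /=.
rewrite [X in _ <= X + _](eq_bigl [in targets S finset.setT]); last by move=> i; rewrite inE.
by rewrite lerDl; apply: sumr_ge0 => i _; apply: ltW (concentration_gt0 pW.1 i).
Qed.

End Balance.

(** * Limits of sampling probabilities *)

Section Marks.
Variables (R : realType) (T : finType) (mu : T -> R) (nu : option T -> R).
Variables (w : T -> T -> R) (n : nat).
Hypothesis nu_sum : \sum_o nu o = 1.

(* Adding independent marks to the types does not change the law of the digraph;
   the marks are what the reserved parts of the blocks are made of. *)
Definition marked_mu (t : T * option T) : R := mu t.1 * nu t.2.

Lemma marked_mu_sum : \sum_t mu t = 1 -> \sum_t marked_mu t = 1.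
Proof.
move=> mu_sum; rewrite -(pair_big predT predT (fun j o => mu j * nu o)) /=.
by under eq_bigr do rewrite -mulr_sumr nu_sum mulr1.
Qed.

Lemma sample_pr_marks (Ev : pred {set 'I_n * 'I_n}) :
  sample_pr marked_mu (lifted_w w) (fun=> Ev) = sample_pr mu w (fun=> Ev).
Proof.
pose unmark (f : {ffun 'I_n -> T * option T}) : {ffun 'I_n -> T} := [ffun i => (f i).1].
rewrite /sample_pr (partition_big unmark predT) //=; apply: eq_bigr => f _.
rewrite (eq_bigr (fun g => types_prob marked_mu g * graph_pr w f Ev)); last first.
  move=> g /eqP gf; congr (_ * _); apply: eq_bigr => E _; apply: eq_bigr => a _.
  by rewrite -gf /arc_prob /lifted_w !ffunE.
rewrite -mulr_suml; congr (_ * _); rewrite /types_prob.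
rewrite (eq_bigl (mem (family (fun i => [pred t | t.1 == f i])))); last first.
  move=> g; apply/eqP/familyP => [<- i|gP]; first by rewrite !inE ffunE.
  by apply/ffunP=> i; rewrite ffunE; have := gP i; rewrite inE => /eqP.
rewrite -(bigA_distr_big_dep (fun i => [pred t | t.1 == f i]) (fun _ => marked_mu)) /=.
apply: eq_bigr => i _.
transitivity (\sum_(p | (p.1 == f i) && true) mu p.1 * nu p.2).
  by apply: eq_bigl => p; rewrite andbT.
rewrite -(pair_big_dep (fun j => j == f i) (fun _ => predT) (fun j o => mu j * nu o)) /=.
by rewrite big_pred1_eq -mulr_sumr nu_sum mulr1.
Qed.
End Marks.

Section FiniteAdditivity.
Context {d : measure_display} {Omega : measurableType d} {R : realType}.
Variable P : probability Omega R.

Lemma measure_finType_bigcup (I : finType) (F : I -> set Omega) (D : pred I) :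
  (forall i, measurable (F i)) -> trivIset setT F ->
  P (\bigcup_(i in [set i | D i]) F i) = (\sum_(i | D i) P (F i))%E.
Proof.
move=> mF tF; have -> : [set i | D i] = [set` [seq i <- index_enum I | D i]].
  by apply/seteqP; split=> i /=; rewrite mem_filter mem_index_enum andbT.
rewrite measure_fin_bigcup //; last by move=> i j _ _; apply: tF.
by rewrite -fsbig_seq ?filter_uniq ?index_enum_uniq // big_filter.
Qed.

End FiniteAdditivity.

Section Transfer.
Context {R : realType} {d : measure_display} {Omega : measurableType d}.
Variables (P : probability Omega R) (W : R * R -> R) (s : seq R).
Variables (n : nat) (G : Omega -> {set 'I_n * 'I_n}).
Hypotheses (gW : graphon W) (pW : partition_for W s) (sG : sampled_from P W G).
Notation T := 'I_(size s).

Definition block_mu (i : T) : R := concentration s i 0.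
Definition block_w (i j : T) : R := W (sigma s i, sigma s j).

Lemma block_mu_gt0 i : 0 < block_mu i.
Proof. exact: concentration_gt0 pW.1 i. Qed.

Lemma block_mu_sum : \sum_i block_mu i = 1.
Proof. exact: sum_concentration pW.1. Qed.

Lemma block_w_itv i j : 0 <= block_w i j <= 1.
Proof.
by apply: gW.2; split; rewrite /= in_itv /= (sigma_itv pW.1) // ltnW.
Qed.

Lemma block_wE i j x y : in_block i x -> in_block j y -> W (x, y) = block_w i j.
Proof.
by move=> xi yj; apply: (pW.2 i j); apply/rectE; split=> //=; apply: in_block_sigma pW.1 _.
Qed.

Lemma support_skeleton i j : support block_w i j = @skeleton R W s i j.
Proof.
by rewrite (skeletonE pW (in_block_sigma pW.1 i) (in_block_sigma pW.1 j)).
Qed.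

Definition block_set (i : T) : set R := [set` `[sigma s i, sigma s i.+1[ ].

Lemma block_setE i x : block_set i x <-> in_block i x.
Proof. by rewrite /block_set /= in_itv. Qed.

Lemma uniform_block i : uniform_prob (@ltr01 R) (block_set i) = (block_mu i)%:E.
Proof.
rewrite /uniform_prob (eq_integral (cst 1%:E)) => [|x].
  rewrite integral_cst /=; last exact: measurable_itv.
  rewrite lebesgue_measure_itv /= lte_fin (sigma_lt pW.1) //.
  by rewrite -EFinB -EFinM mul1r /block_mu mxE.
rewrite inE => /block_setE/(in_block_itv pW.1)/andP[x0 /ltW x1].
by rewrite /uniform_pdf x0 x1 subr0 invr1.
Qed.

Lemma arcs_probE (x : 'I_n -> R) (f : {ffun 'I_n -> T}) (E : {set 'I_n * 'I_n}) :
    (forall i, in_block (f i) (x i)) -> (forall i, (i, i) \notin E) ->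
  edges_prob W x E = arcs_prob block_w f E.
Proof.
move=> xf nE; rewrite /edges_prob /arcs_prob [RHS](bigID (fun a => a.1 != a.2)) /=.
rewrite [X in _ = _ * X]big1 ?mulr1.
  apply: eq_bigr => -[u v] /= uv; rewrite /arc_prob /= (negbTE uv).
  by rewrite (block_wE (xf u) (xf v)).
move=> [u v]; rewrite negbK /= => /eqP->; rewrite (negbTE (nE v)) /arc_prob eqxx.
by rewrite subr0.
Qed.

Lemma arcs_prob_loop (f : {ffun 'I_n -> T}) (E : {set 'I_n * 'I_n}) i :
  (i, i) \in E -> arcs_prob block_w f E = 0.
Proof.
by move=> Ei; rewrite /arcs_prob (bigD1 (i, i)) //= Ei /arc_prob eqxx mul0r.
Qed.

Lemma measurable_graph E : measurable (G @^-1` [set E]).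
Proof. by case: sG => t []. Qed.

Definition graph_mass (E : {set 'I_n * 'I_n}) : R :=
  \sum_f types_prob block_mu f * arcs_prob block_w f E.

Lemma graph_mass_le E : ((graph_mass E)%:E <= P (G @^-1` [set E]))%E.
Proof.
have [|noloop] := boolP [exists i, (i, i) \in E].
  case/existsP=> i Ei; rewrite /graph_mass big1 ?measure_ge0 // => f _.
  by rewrite (arcs_prob_loop _ Ei) mulr0.
have nE i : (i, i) \notin E by apply: contra noloop => Ei; apply/existsP; exists i.
have [t [tU tI _ _ tG]] := sG.
pose A (f : {ffun 'I_n -> T}) := \bigcap_i (t i @^-1` block_set (f i)).
have mB i : measurable (block_set i) by apply: measurable_itv.
have mA f : measurable (A f).
  apply: fin_bigcap_measurable; first exact: finite_finset.
  by move=> i _; apply: measurable_funPTI.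
have PA f : P (A f) = (types_prob block_mu f)%:E.
  rewrite /A tI // /types_prob -prodEFin; apply: eq_bigr => i _.
  by rewrite -uniform_block -(tU i).
have PAE f : P (A f `&` G @^-1` [set E]) =
    (types_prob block_mu f * arcs_prob block_w f E)%:E.
  rewrite tG //; last first.
    move=> i; split=> // x /block_setE/(in_block_itv pW.1)/andP[x0 /ltW x1].
    by rewrite /= in_itv /= x0 x1.
  rewrite (eq_integral (cst (arcs_prob block_w f E)%:E)); last first.
    move=> o; rewrite inE => Ao; rewrite (arcs_probE (f := f)) // => i.
    by apply/block_setE; apply: Ao.
  rewrite integral_cst; last exact: mA.
  by rewrite -/(A f); move: (PA f) => /= ->; rewrite -EFinM mulrC.
have disj : trivIset setT (fun f => A f `&` G @^-1` [set E]).
  move=> f g _ _ [om [[Af _] [Ag _]]]; apply/ffunP=> i.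
  apply: (in_block_inj pW.1 (x := t i om)); apply/block_setE; [exact: Af|exact: Ag].
rewrite /graph_mass -sumEFin; under eq_bigr do rewrite -PAE.
rewrite -(@measure_finType_bigcup _ _ _ P _ _ predT) //; last first.
  by move=> f; apply: measurableI => //; apply: measurable_graph.
apply: le_measure; rewrite ?inE; first last.
- by move=> o [f _ []].
- exact: measurable_graph.
apply: fin_bigcup_measurable; first exact: finite_finset.
by move=> f _; apply: measurableI => //; apply: measurable_graph.
Qed.

Lemma trivIset_graph : trivIset setT (fun E => G @^-1` [set E]).
Proof. by move=> E F _ _ [om [/= <- <-]]. Qed.

(* Both sides sum to 1 over E, so the inequalities [graph_mass_le] are equalities;
   this avoids discussing coordinates equal to 1. *)
Lemma graph_massE E : P (G @^-1` [set E]) = (graph_mass E)%:E.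
Proof.
pose p E := fine (P (G @^-1` [set E])).
have pE F : P (G @^-1` [set F]) = (p F)%:E.
  by rewrite fineK // fin_num_measure //; apply: measurable_graph.
have le_p F : graph_mass F <= p F by rewrite -lee_fin -pE graph_mass_le.
have sum_p : \sum_F p F = 1.
  apply: EFin_inj; rewrite -sumEFin; under eq_bigr do rewrite -pE.
  rewrite -(@measure_finType_bigcup _ _ _ P _ _ predT) //; last exact: trivIset_graph.
    rewrite -(probability_setT P); congr (P _); apply/seteqP; split=> // o _.
    by exists (G o).
  exact: measurable_graph.
have sum_q : \sum_F graph_mass F = 1.
  rewrite /graph_mass exchange_big /= -(sample_pr1 block_w n block_mu_sum).
  apply: eq_bigr => f _; rewrite -mulr_sumr //.
rewrite pE; congr EFin; apply/le_anti/andP; split=> //.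
have : \sum_F (p F - graph_mass F) = 0 by rewrite sumrB sum_p sum_q subrr.
rewrite (bigD1 E) //=; have : 0 <= \sum_(F | F != E) (p F - graph_mass F).
  by apply: sumr_ge0 => F _; rewrite subr_ge0.
by move: (\sum_(F | _) _) => x; lra.
Qed.

Lemma sampled_prE (Ev : {set 'I_n * 'I_n} -> Prop) :
  P [set o | Ev (G o)] =
    (sample_pr block_mu block_w (fun=> [pred E | `[< Ev E >]]))%:E.
Proof.
pose D := [pred E | `[< Ev E >]].
have -> : [set o | Ev (G o)] = \bigcup_(E in [set E | D E]) (G @^-1` [set E]).
  apply/seteqP; split=> o /=; first by move=> Evo; exists (G o) => //; apply/asboolP.
  by case=> E /asboolP EvE /= ->.
rewrite measure_finType_bigcup; [|exact: measurable_graph|exact: trivIset_graph].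
under eq_bigr do rewrite graph_massE; rewrite sumEFin; congr EFin.
rewrite /graph_mass exchange_big /=; apply: eq_bigr => f _.
by rewrite -mulr_sumr.
Qed.
End Transfer.

Section Vanishes.
Variable R : realType.
Implicit Types r : nat -> R.

Definition vanishes r := forall eps, 0 < eps -> exists N, forall n, (N <= n)%N -> r n <= eps.

Lemma vanishes_harmonic r C N :
  (forall n, (N < n)%N -> r n <= C / n%:R) -> vanishes r.
Proof.
move=> rC eps eps0; have [K [K0 leK]] := nat_upper_bound (C / eps).
exists (maxn K N.+1) => n; rewrite geq_max => /andP[leKn ltNn].
apply: le_trans (rC n ltNn) _; have n0 : 0 < n%:R :> R by rewrite ltr0n (leq_trans _ ltNn).
rewrite ler_pdivrMr // mulrC -ler_pdivrMr //; apply: le_trans leK _.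
by rewrite ler_nat.
Qed.

Lemma vanishes_le r1 r2 N : (forall n, (N <= n)%N -> r1 n <= r2 n) -> vanishes r2 ->
  vanishes r1.
Proof.
move=> le12 v2 eps /v2[M leM]; exists (maxn N M) => n.
by rewrite geq_max => /andP[Nn Mn]; apply: le_trans (le12 n Nn) (leM n Mn).
Qed.

Lemma vanishes_cvg0 r : (forall n, 0 <= r n) -> vanishes r ->
  (r n)%:E @[n --> \oo] --> 0%E.
Proof.
move=> r0 vr; apply: cvg_EFin; first by near=> n.
apply/cvgrPdist_le => eps eps0; have [N leN] := vr eps eps0.
near=> n; rewrite sub0r normrN ger0_norm //; apply: leN.
by near: n; exists N.
Unshelve. all: by end_near. Qed.

Lemma vanishes_cvg1 r : (forall n, r n <= 1) -> vanishes (fun n => 1 - r n) ->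
  (r n)%:E @[n --> \oo] --> 1%E.
Proof.
move=> r1 vr; apply: cvg_EFin; first by near=> n.
apply/cvgrPdist_le => eps eps0; have [N leN] := vr eps eps0.
near=> n; rewrite ger0_norm ?subr_ge0 //; apply: leN.
by near: n; exists N.
Unshelve. all: by end_near. Qed.

End Vanishes.

Section SampleLimits.
Variables (R : realType) (T : finType) (mu : T -> R) (w : T -> T -> R).
Hypotheses (mu_gt0 : forall t, 0 < mu t) (mu_sum : \sum_t mu t = 1).
Hypothesis w_itv : forall t u, 0 <= w t u <= 1.

Let mu_ge0 t : 0 <= mu t. Proof. exact: ltW. Qed.

Lemma sample_pr_types n (Ev : pred {set 'I_n * 'I_n}) (bad : pred {ffun 'I_n -> T}) :
    (forall f E, 0 < arcs_prob w f E -> Ev E -> bad f) ->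
  sample_pr mu w (fun=> Ev) <= types_pr mu bad.
Proof.
move=> bad_of; rewrite -[leRHS]addr0; apply: sample_pr_bound => // f nbad _.
rewrite /graph_pr big1 // => E EvE; apply/eqP.
have := arcs_prob_ge0 w_itv f E; rewrite le0r => /orP[//|E0].
by rewrite (bad_of f E E0 EvE) in nbad.
Qed.

Lemma types_dev_vanishes h : 0 < h ->
  vanishes (fun n => types_pr mu (fun f : {ffun 'I_n -> T} =>
    [exists t, h * n%:R < `|(block_card f t)%:R - n%:R * mu t|])).
Proof.
move=> h0; apply: (@vanishes_harmonic _ _ (#|T|%:R / h ^+ 2) 0) => n n0.
exact: types_pr_dev.
Qed.

Lemma level_vanishes (q : T -> R) a b : q a != q b ->
  vanishes (fun n => types_pr mu (fun f : {ffun 'I_n -> T} => \sum_v q (f v) == 0)).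
Proof.
move=> qab eps eps0.
have [J [J0 leJ]] := nat_upper_bound (3 / eps).
have Jgt0 : 0 < J%:R :> R by rewrite ltr0n.
pose D := 2 / (mu a * mu b); have D0 : 0 < D by rewrite divr_gt0 ?mulr_gt0.
pose h := eps / (3 * (J%:R * D)).
have JD0 : 0 < J%:R * D by rewrite mulr_gt0.
have h0 : 0 < h by apply: divr_gt0 => //; apply: mulr_gt0.
have [N [N0 leN]] := nat_upper_bound (3 * (J%:R * D) / (eps * h)).
exists N => n leNn; have n_gt0 : (0 < n)%N by apply: leq_trans leNn.
have n0 : 0 < n%:R :> R by rewrite ltr0n.
apply: le_trans (level_pr mu_gt0 mu_sum qab h0 n_gt0 J0) _.
have -> : J%:R * (2 * (h + (h * n%:R)^-1) / (mu a * mu b)) =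
    J%:R * D * h + J%:R * D / (h * n%:R).
  by rewrite /D; field; rewrite !gt_eqF.
have e1 : J%:R^-1 <= eps / 3.
  have : 3 <= J%:R * eps by rewrite -ler_pdivrMr.
  by rewrite -(ler_pM2l Jgt0) mulfV ?gt_eqF //; lra.
have e2 : J%:R * D * h = eps / 3 by rewrite /h; field; rewrite !gt_eqF.
have e3 : J%:R * D / (h * n%:R) <= eps / 3.
  have eh0 : 0 < eps * h by apply: mulr_gt0.
  have hn0 : 0 < h * n%:R by apply: mulr_gt0.
  rewrite (ler_pdivrMr _ _ hn0); move: leN; rewrite (ler_pdivrMr _ _ eh0) => leN.
  have : N%:R * (eps * h) <= n%:R * (eps * h) by rewrite ler_wpM2r ?ler_nat ?(ltW eh0).
  by lra.
by rewrite e2; lra.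
Qed.

Lemma orthogonal_cover_vanishes (q : T -> R) i : q i != 0 ->
    (forall c, dicycle (support w) c -> \sum_(j <- c) q j = 0) ->
  vanishes (fun n => sample_pr mu w
    (fun=> [pred E : {set 'I_n * 'I_n} | `[< has_cycle_cover (edge_rel E) >]])).
Proof.
move=> qi q0.
have le_level n : (0 <= n)%N -> sample_pr mu w
    (fun=> [pred E : {set 'I_n * 'I_n} | `[< has_cycle_cover (edge_rel E) >]]) <=
    types_pr mu (fun f : {ffun 'I_n -> T} => \sum_v q (f v) == 0).
  move=> _; apply: sample_pr_types => f E E0 /asboolP cover; apply/eqP.
  by apply: (cover_sum_eq0 (tau := f) _ q0 cover) => u v; apply: arcs_prob_edge E0.
apply: (vanishes_le le_level).
have [/existsP[a qa]|] := boolP [exists a, q a != q i]; first exact: level_vanishes qa.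
rewrite negb_exists => /forallP qE eps eps0; exists 1%N => n n0.
rewrite /types_pr big1 ?ltW // => f /eqP; under eq_bigr => v _.
  have /negPn/eqP -> := qE (f v); over.
move/eqP; rewrite sumr_const card_ord mulrn_eq0 (negbTE qi) orbF => /eqP n_eq0.
by rewrite n_eq0 in n0.
Qed.

Lemma separated_cover_vanishes (q : T -> R) : \sum_t q t * mu t < 0 ->
    (forall c, dicycle (support w) c -> 0 <= \sum_(j <- c) q j) ->
  vanishes (fun n => sample_pr mu w
    (fun=> [pred E : {set 'I_n * 'I_n} | `[< has_cycle_cover (edge_rel E) >]])).
Proof.
move=> qmu q0; set m := \sum_t _ in qmu; pose Q := 1 + \sum_t `|q t|.
have Q0 : 0 < Q by rewrite ltr_pwDl // sumr_ge0.
pose h := - m / (2 * Q); have h0 : 0 < h by rewrite divr_gt0 ?oppr_gt0 ?mulr_gt0.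
apply: (vanishes_le (N := 1) _ (types_dev_vanishes h0)) => n n0.
apply: sample_pr_types => f E E0 /asboolP cover; apply: contraT.
rewrite negb_exists => /forallP dev.
have : 0 <= \sum_v q (f v).
  by apply: (cover_sum_ge0 (tau := f) _ q0 cover) => u v; apply: arcs_prob_edge E0.
rewrite sum_block_card leNgt; move/negP; case.
have n_gt0 : 0 < n%:R :> R by rewrite ltr0n.
apply: (@le_lt_trans _ _ (n%:R * m + h * n%:R * (Q - 1))).
  rewrite /m /Q [1 + _]addrC addrK !mulr_sumr -big_split /=; apply: ler_sum => t _.
  have := dev t; rewrite -leNgt; set N := (block_card f t)%:R => le_dev.
  have : q t * (N - n%:R * mu t) <= `|q t| * (h * n%:R).
    by apply: le_trans (ler_norm _) _; rewrite normrM ler_wpM2l.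
  by lra.
have hQ : h * Q = - m / 2 by rewrite /h; field; rewrite gt_eqF.
have : n%:R * m + h * n%:R * (Q - 1) <= n%:R * (m / 2).
  have : 0 <= h * n%:R by rewrite mulr_ge0 ?ltW.
  have : h * n%:R * Q = n%:R * (- m / 2) by rewrite -hQ; ring.
  by lra.
by move/le_lt_trans; apply; rewrite pmulr_rlt0 // pmulr_llt0 // invr_gt0.
Qed.

Lemma disconnected_hamilton_vanishes i j : ~~ connect (support w) i j ->
  vanishes (fun n => sample_pr mu w
    (fun=> [pred E : {set 'I_n * 'I_n} | `[< has_hamilton_cycle (edge_rel E) >]])).
Proof.
move=> nij; have [m [/andP[m0 m1] m_le]] := positive_lower_bound mu_gt0.
have h0 : 0 < m / 2 by rewrite divr_gt0.
apply: (vanishes_le (N := 1) _ (types_dev_vanishes h0)) => n n0.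
have n_gt0 : 0 < n%:R :> R by rewrite ltr0n.
apply: sample_pr_types => f E E0 /asboolP ham; apply: contraT.
rewrite negb_exists => /forallP dev.
have occupied t : exists v, f v = t.
  have : (0 < block_card f t)%N.
    rewrite lt0n; apply/eqP=> c0; have := dev t; rewrite c0 -leNgt sub0r normrN.
    rewrite ger0_norm ?mulr_ge0 ?(ltW n_gt0) //.
    have : n%:R * m <= n%:R * mu t by rewrite ler_wpM2l ?(ltW n_gt0).
    have : 0 < n%:R * m by rewrite mulr_gt0.
    by lra.
  by case/card_gt0P=> v; rewrite inE => /eqP; exists v.
have [u fu] := occupied i; have [v fv] := occupied j.
case/negP: nij; rewrite -fu -fv.
by apply: (hamilton_connect (tau := f) _ u v ham) => x y; apply: arcs_prob_edge E0.
Qed.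

End SampleLimits.

Section Thresholds.
Variables (T : finType) (M1 M2 K D n : nat).
Hypotheses (M2_gt0 : (0 < M2)%N) (D_gt0 : (0 < D)%N).
Hypotheses (M1_ge : (#|T| * #|T|.+2 + 8 * K.+1 < M1)%N) (le_n : (D * (M1 * M2) <= n)%N).
Local Notation e := (n %/ (D * (M1 * M2)))%N.
Local Notation d := (n %/ D)%N.

Lemma threshold_gt0 : (0 < e)%N.
Proof. by rewrite divn_gt0 // !muln_gt0 D_gt0 M2_gt0 andbT (leq_ltn_trans _ M1_ge). Qed.

Lemma threshold_lt c : (c < M1)%N -> (c * e < d)%N.
Proof.
move=> ltc; have le_d : (M1 * M2 * e <= d)%N by rewrite divnMA mulnC leq_divM.
apply: leq_trans le_d; rewrite ltn_mul2r threshold_gt0 /=.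
by apply: leq_trans ltc _; rewrite leq_pmulr.
Qed.
End Thresholds.

Section Embedding.
Variables (R : realType) (T : finType) (mu : T -> R) (w : T -> T -> R).
Hypotheses (mu_gt0 : forall t, 0 < mu t) (mu_sum : \sum_t mu t = 1).
Hypothesis w_itv : forall t u, 0 <= w t u <= 1.
Notation S := (support w).
Notation U := (T * option T)%type.
Notation mass I := (\sum_(i in I) mu i).
Hypothesis balance : forall I : {set T}, targets S I = I \/ mass I < mass (targets S I).

Lemma uniform_gap : exists gam : R, [/\ 0 < gam <= 1, forall i, gam <= mu i &
  forall I : {set T}, targets S I = I \/ mass I + gam <= mass (targets S I)].
Proof.
pose gap I := mass (targets S I) - mass I.
have [I|gam [/andP[gam0 gam1] gamP]] := @positive_lower_bound R {set T}
    (fun I => if 0 < gap I then gap I else 1).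
  by case: ifP.
have [m [/andP[m0 m1] mP]] := positive_lower_bound mu_gt0.
exists (Num.min gam m); split=> [|i|I].
- by rewrite lt_min gam0 m0 ge_min gam1.
- by apply: le_trans (mP i); rewrite ge_min lexx orbT.
case: (balance I) => [->|ltI]; [by left|right].
have : Num.min gam m <= gam by rewrite ge_min lexx.
by have := gamP I; rewrite /gap subr_gt0 ltI; lra.
Qed.

Lemma mass_le1 (I : {set T}) : mass I <= 1.
Proof.
rewrite -mu_sum [leRHS](bigID [in I]) /= lerDl.
by apply: sumr_ge0 => i _; apply: ltW.
Qed.

Lemma card_preim_dev n (f : {ffun 'I_n -> U}) (m : U -> R) (J : {set U}) h :
  (forall u, `|#|fiber f u|%:R - n%:R * m u| <= h * n%:R) -> 0 <= h ->
  `|#|f @^-1: J|%:R - n%:R * \sum_(u in J) m u| <= #|{: U}|%:R * (h * n%:R).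
Proof.
move=> dev h0; have -> : #|f @^-1: J| = (\sum_(u in J) #|fiber f u|)%N.
  rewrite -sum1_card (partition_big f (mem J)) => [|v]; last by rewrite inE.
  apply: eq_bigr => u Ju; rewrite -sum1_card; apply: eq_bigl => v.
  by rewrite !inE; case: eqP => [->|]; rewrite ?andbF // andbT; apply: Ju.
rewrite natr_sum mulr_sumr -sumrB; apply: le_trans (ler_norm_sum _ _ _) _.
apply: (@le_trans _ _ (\sum_(u : U) h * n%:R)).
  rewrite big_mkcond /=; apply: ler_sum => u _.
  by case: ifP => _; [apply: dev|rewrite mulr_ge0].
by rewrite sumr_const -[X in X <= _]mulr_natl.
Qed.

Lemma quasirandom_limit (Ev : forall n, {set 'I_n * 'I_n} -> Prop) :
    (forall (gam : R) (K M1 M2 D n : nat) (nu : option T -> R) (f : {ffun 'I_n -> U})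
       (E : {set 'I_n * 'I_n}),
     [/\ 0 < gam /\ (forall i, gam <= mu i),
        (forall I : {set T}, targets S I = I \/ mass I + gam <= mass (targets S I)),
        (0 < M2)%N, (0 < D)%N & (0 < K)%N] ->
     [/\ (#|T| * #|T|.+2 + 8 * K.+1 < M1)%N, (D * (M1 * M2) <= n)%N &
      (#|T| * #|T|.+2 * (n %/ (D * (M1 * M2))))%:R <= gam / 4 * n%:R] ->
     \sum_o nu o = 1 -> 1 - gam / 4 <= nu None ->
     (forall J : {set U},
        `|#|f @^-1: J|%:R - n%:R * \sum_(u in J) marked_mu mu nu u| <= gam / 8 * n%:R) ->
     quasirandom f S (edge_rel E) (n %/ (D * (M1 * M2))) (n %/ D) K -> Ev n E) ->
  vanishes (fun n => 1 - sample_pr mu w (fun=> [pred E : {set 'I_n * 'I_n} | `[< Ev n E >]])).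
Proof.
move=> EvP; have [gam [/andP[gam0 gam1] gam_le gapP]] := uniform_gap.
pose th := gam / (4 * #|T|.+1%:R).
have T1 : 0 < #|T|.+1%:R :> R by rewrite ltr0n.
have th0 : 0 < th by rewrite divr_gt0 ?mulr_gt0.
have Tth : #|T|%:R * th <= gam / 4.
  have : #|T|.+1%:R * th = gam / 4 by rewrite /th; field; rewrite gt_eqF.
  by rewrite -natr1; lra.
pose nu (o : option T) := if o is Some _ then th else 1 - #|T|%:R * th.
have nu_gt0 o : 0 < nu o by case: o => //=; lra.
have nu_sum : \sum_o nu o = 1.
  rewrite (bigD1 None) //= (eq_bigr (fun=> th)); last by case.
  have cT : #|[pred o : option T | o != None]| = #|T|.
    by rewrite (cardC1 (None : option T)) card_option.
  by rewrite sumr_const cT -[th *+ _]mulr_natl subrK.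
pose mu' := marked_mu mu nu.
have mu'_gt0 u : 0 < mu' u by rewrite mulr_gt0.
have mu'_sum : \sum_u mu' u = 1 by apply: marked_mu_sum.
have mu'_ge0 u : 0 <= mu' u by apply: ltW.
have [K [D [K0 D0 whp]]] := good_sample_whp mu'_gt0 mu'_sum w_itv.
have [M2 [M20 M2_ge]] := nat_upper_bound ((#|T| * #|T|.+2)%:R * 4 / gam).
pose M1 := (#|T| * #|T|.+2 + 8 * K.+1).+1; pose M := (D * (M1 * M2))%N.
pose h := gam / (8 * #|{: U}|.+1%:R).
have U1 : 0 < #|{: U}|.+1%:R :> R by rewrite ltr0n.
have h0 : 0 < h by rewrite divr_gt0 ?mulr_gt0.
have Uh : #|{: U}|%:R * h <= gam / 8.
  have : #|{: U}|.+1%:R * h = gam / 8 by rewrite /h; field; rewrite gt_eqF.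
  by rewrite -natr1; lra.
have M0 : (0 < M)%N by rewrite !muln_gt0 D0 M20.
have [C leC] := whp M h M0 h0.
apply: (@vanishes_harmonic _ _ C M) => n ltMn.
have n_gt0 : (0 < n)%N by apply: leq_ltn_trans ltMn.
have n0 : 0 < n%:R :> R by rewrite ltr0n.
rewrite -(sample_pr_marks mu w nu_sum).
rewrite (@sample_prC _ _ mu' (lifted_w w) n mu'_sum) opprB addrC subrK.
apply: le_trans (leC n n_gt0); apply: (le_sample_pr mu'_ge0) => f.
apply: (le_graph_pr (lifted_w_itv w_itv)) => E nEv E0; apply: contra nEv.
case/andP=> /forallP dev /asboolP qr; apply/asboolP.
apply: (EvP gam K M1 M2 D n nu f E) => //.
  split=> //; first exact: ltnW.
  have le_eM : (M * (n %/ M) <= n)%N by rewrite mulnC leq_divM.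
  have M2e : (M2 * (n %/ M) <= n)%N.
    apply: leq_trans le_eM; rewrite leq_mul2r; apply/orP; right.
    by rewrite /M mulnA leq_pmull // muln_gt0 D0.
  move: M2e; rewrite -(ler_nat R) !natrM -/M => M2e.
  move: M2_ge; rewrite ler_pdivrMr // natrM => M2_ge.
  have e0 : 0 <= (n %/ M)%:R :> R by [].
  have := ler_wpM2r e0 M2_ge; have := ler_wpM2l (ltW gam0) M2e.
  by lra.
- by rewrite /=; lra.
move=> J; apply: le_trans (card_preim_dev _ dev (ltW h0)) _.
by rewrite mulrA ler_wpM2r // ltW.
Qed.

Lemma sum_marked_fst (nu : option T -> R) (I : {set T}) : \sum_o nu o = 1 ->
  \sum_(u in [set u : U | u.1 \in I]%SET) marked_mu mu nu u = mass I.
Proof.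
move=> nu1; transitivity (\sum_(u | (u.1 \in I) && true) mu u.1 * nu u.2).
  by apply: eq_bigl => u; rewrite inE andbT.
rewrite -(pair_big_dep (mem I) (fun _ => predT) (fun j o => mu j * nu o)) /=.
by apply: eq_bigr => i _; rewrite -mulr_sumr nu1 mulr1.
Qed.

Lemma sum_marked_None (nu : option T -> R) (I : {set T}) :
  \sum_(u in [set u : U | (u.1 \in I) && (u.2 == None)]%SET) marked_mu mu nu u = mass I * nu None.
Proof.
transitivity (\sum_(u | (u.1 \in I) && (u.2 == None)) mu u.1 * nu u.2).
  by apply: eq_bigl => u; rewrite inE.
rewrite -(pair_big_dep (mem I) (fun _ o => o == None) (fun j o => mu j * nu o)) /=.
by rewrite mulr_suml; apply: eq_bigr => i _; rewrite big_pred1_eq.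
Qed.

Lemma preim_fst n (f : {ffun 'I_n -> U}) (I : {set T}) :
  (fun v => (f v).1) @^-1: I = f @^-1: [set u : U | u.1 \in I]%SET.
Proof. by apply/setP=> v; rewrite !inE. Qed.

Lemma cover_whp : vanishes (fun n => 1 - sample_pr mu w
  (fun=> [pred E : {set 'I_n * 'I_n} | `[< has_cycle_cover (edge_rel E) >]])).
Proof.
apply: (quasirandom_limit (Ev := fun n E => has_cycle_cover (edge_rel E))).
move=> gam K M1 M2 D n nu f E [[gam0 gam_le] gapP M20 D0 K0] [M1_ge le_n le_e] nu1 _ dev qr.
have e0 := threshold_gt0 M20 D0 M1_ge le_n.
have [||s sE] := quasirandom_cycle_cover qr e0; last exact: perm_cycle_cover sE.
  move=> I; case: (gapP I) => [->|le_gap]; [by left|right].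
  rewrite !preim_fst -(ler_nat R) natrD.
  have := dev [set u : U | u.1 \in I]%SET.
  have := dev [set u : U | u.1 \in targets S I]%SET.
  rewrite !sum_marked_fst // !ler_norml => /andP[lo _] /andP[_ hi].
  have n_ge0 : 0 <= n%:R :> R by [].
  have le_gap_n := ler_wpM2l n_ge0 le_gap.
  have gn : 0 <= gam * n%:R by rewrite mulr_ge0 // ltW.
  have : (2 * #|T| * (n %/ (D * (M1 * M2))))%:R <= gam / 4 * n%:R :> R.
    apply: le_trans le_e; rewrite ler_nat leq_mul2r; apply/orP; right.
    by rewrite mulnC leq_mul2l orbT.
  by lra.
apply: (threshold_lt M20 D0 M1_ge le_n); apply: leq_ltn_trans M1_ge.
by apply: leq_trans (leq_addr _ _); rewrite mulnC leq_mul2l orbT.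
Qed.

Hypotheses (S_conn : forall i j, connect S i j).
Hypotheses (S_in : forall j, exists i, S i j) (S_out : forall i, exists j, S i j).

Lemma hamilton_whp : vanishes (fun n => 1 - sample_pr mu w
  (fun=> [pred E : {set 'I_n * 'I_n} | `[< has_hamilton_cycle (edge_rel E) >]])).
Proof.
apply: (quasirandom_limit (Ev := fun n E => has_hamilton_cycle (edge_rel E))).
move=> gam K M1 M2 D n nu f E [[gam0 gam_le] gapP M20 D0 K0] [M1_ge le_n le_e] nu1 nuN dev qr.
have e0 := threshold_gt0 M20 D0 M1_ge le_n.
have n_ge0 : 0 <= n%:R :> R by [].
have n_gt0 : (0 < n)%N.
  by apply: leq_trans le_n; rewrite !muln_gt0 D0 M20 andbT (leq_ltn_trans _ M1_ge).
have gap_pr (I : {set T}) : I != finset.set0 -> I != finset.setT ->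
    mass I + gam <= mass (targets S I).
  move=> /set0Pn[i Ii] /eqP nT; case: (gapP I) => // tI; case: nT.
  apply/setP=> j; rewrite inE; have /connectP[p] := S_conn i j.
  elim: p i Ii => [|k p IHp] i Ii /= => [_ ->//|/andP[Sik kp]].
  by apply: IHp kp; rewrite -tI; apply/targetsP; exists i.
have [||||s [sE one]] := quasirandom_hamilton qr e0 K0 _ S_conn S_in S_out.
- move=> i; have [|[v]] := set_0Vmem (f @^-1: [set u : U | u.1 \in [set i]%SET]%SET).
    move=> J0; have := dev [set u : U | u.1 \in [set i]%SET]%SET.
    rewrite J0 cards0 sum_marked_fst // big_set1 sub0r normrN ger0_norm; last first.
      by rewrite mulr_ge0 // ltW.
    have n0 : 0 < n%:R :> R by rewrite ltr0n.
    have := ler_wpM2l n_ge0 (gam_le i); have : 0 < gam * n%:R by apply: mulr_gt0.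
    by lra.
  by rewrite !inE => /eqP; exists v.
- move=> I I0 IT; rewrite preim_fst -(ler_nat R) natrD.
  have := dev [set u : U | u.1 \in I]%SET.
  have := dev [set u : U | (u.1 \in targets S I) && (u.2 == None)]%SET.
  rewrite sum_marked_fst // sum_marked_None !ler_norml => /andP[lo _] /andP[_ hi].
  have le_gap_n := ler_wpM2l n_ge0 (gap_pr I I0 IT).
  have mnu : mass (targets S I) - gam / 4 <= mass (targets S I) * nu None.
    have m0 : 0 <= mass (targets S I) by apply: sumr_ge0 => i _; apply: ltW.
    have := ler_wpM2l m0 nuN; have := mass_le1 (targets S I).
    have : 0 <= gam / 4 by lra.
    by move=> g0 m1 H; have := ler_wpM2r g0 m1; lra.
  have gn : 0 <= gam * n%:R by rewrite mulr_ge0 // ltW.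
  have := ler_wpM2l n_ge0 mnu.
  by lra.
- apply: (threshold_lt M20 D0 M1_ge le_n); apply: leq_ltn_trans M1_ge.
  exact: leq_addr.
- rewrite mulnAC; apply: ltnW; apply: (threshold_lt M20 D0 M1_ge le_n).
  by apply: leq_ltn_trans M1_ge; apply: leq_addl.
by apply: (perm_hamilton_cycle sE (Ordinal n_gt0)).
Qed.

End Embedding.

Lemma step_graphon_partition (R : realType) (W : R * R -> R) : step_graphon W ->
  exists s, partition_for W s /\ (1 < size s)%N.
Proof.
case=> _ [s [ps Ws]]; have [lt1|] := ltnP 1 (size s); first by exists s; split.
have := size_partition_gt0 ps; case: s ps Ws => [//|x [|//]] ps Ws _ _.
have x1 : x = 1 by case: ps => _ /eqP.
exists [:: 2^-1; 1]; split=> //.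
have ps' : itv_partition 0 1 [:: 2^-1; 1 : R].
  by split=> //=; rewrite invr_gt0 ltr0n /= andbT; lra.
split=> // i j p q /rectE[p1 p2] /rectE[q1 q2].
apply: (Ws ord0 ord0); apply/rectE; rewrite /in_block /sigma /= x1; split.
- exact: (in_block_itv ps' p1).
- exact: (in_block_itv ps' p2).
- exact: (in_block_itv ps' q1).
- exact: (in_block_itv ps' q2).
Qed.

Section SampledGraphs.
Variables (R : realType) (W : R * R -> R).
Variables (d : nat -> measure_display) (Omega : forall n : nat, measurableType (d n)).
Variables (P : forall n : nat, probability (Omega n) R).
Variable G : forall n : nat, Omega n -> {set 'I_n * 'I_n}.
Hypotheses (gW : graphon W) (sG : forall n, sampled_from (P n) W (@G n)).
Variable s : seq R.
Hypothesis pW : partition_for W s.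
Notation mu := (block_mu (s := s)).
Notation w := (@block_w R W s).

Let mu_gt0 := block_mu_gt0 pW.
Let mu_sum := block_mu_sum pW.
Let w_itv := block_w_itv gW pW.

Lemma skeleton_support : @skeleton R W s = support w.
Proof. by apply/funext=> i; apply/funext=> j; rewrite (support_skeleton pW). Qed.

Lemma sampled_cvg0 (Ev : forall n, {set 'I_n * 'I_n} -> Prop) :
  vanishes (fun n => sample_pr mu w (fun=> [pred E : {set 'I_n * 'I_n} | `[< Ev n E >]])) ->
  P n [set o | Ev n (G o)] @[n --> \oo] --> 0%E.
Proof.
rewrite (_ : (fun n => P n _) = (fun n => (sample_pr mu w
  (fun=> [pred E : {set 'I_n * 'I_n} | `[< Ev n E >]]))%:E)); last first.
  by apply/funext=> n; apply: sampled_prE (sG n) (Ev n).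
by apply: vanishes_cvg0 => n; apply: sample_pr_ge0 w_itv _ => t; apply: ltW.
Qed.

Lemma sampled_cvg1 (Ev : forall n, {set 'I_n * 'I_n} -> Prop) :
  vanishes (fun n => 1 - sample_pr mu w (fun=> [pred E : {set 'I_n * 'I_n} | `[< Ev n E >]])) ->
  P n [set o | Ev n (G o)] @[n --> \oo] --> 1%E.
Proof.
rewrite (_ : (fun n => P n _) = (fun n => (sample_pr mu w
  (fun=> [pred E : {set 'I_n * 'I_n} | `[< Ev n E >]]))%:E)); last first.
  by apply/funext=> n; apply: sampled_prE (sG n) (Ev n).
by apply: vanishes_cvg1 => n; apply: sample_pr_le1 mu_sum w_itv _ => t; apply: ltW.
Qed.

End SampledGraphs.

Theorem theorem2 (R : realType) (W : R * R -> R)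
    (d : nat -> measure_display) (Omega : forall n : nat, measurableType (d n))
    (P : forall n : nat, probability (Omega n) R)
    (G : forall n : nat, Omega n -> {set 'I_n * 'I_n}) :
  step_graphon W ->
  (forall n : nat, sampled_from (P n) W (G n)) ->
  [/\ (~ satisfies W (@condition_A R) \/ ~ satisfies W (@condition_B' R) ->
        P n [set w | has_cycle_cover (edge_rel (G n w))] @[n --> \oo]
          --> 0%E),
      (satisfies W (@condition_A R) -> satisfies W (@condition_B R) ->
       ~ satisfies W (@condition_C R) ->
        P n [set w | has_cycle_cover (edge_rel (G n w))] @[n --> \oo]
          --> 1%E /\
        P n [set w | has_hamilton_cycle (edge_rel (G n w))] @[n --> \oo]
          --> 0%E)
    & (satisfies W (@condition_A R) -> satisfies W (@condition_B R) ->
       satisfies W (@condition_C R) ->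
        P n [set w | has_hamilton_cycle (edge_rel (G n w))] @[n --> \oo]
          --> 1%E)].
Proof.
move=> sW sG; have gW := sW.1.
pose cover n (E : {set 'I_n * 'I_n}) := has_cycle_cover (edge_rel E).
pose hamilton n (E : {set 'I_n * 'I_n}) := has_hamilton_cycle (edge_rel E).
split.
- have [s [pW s_gt1]] := step_graphon_partition sW.
  have skE := skeleton_support pW => nAB; apply: (sampled_cvg0 gW sG pW (Ev := cover)).
  case: nAB => [nA|nB'].
    have : ~ condition_A W s by move=> A; apply: nA; exists s.
    move/condition_AP => /existsNP[q /not_implyP[q0 /existsNP[i /eqP qi]]].
    apply: (orthogonal_cover_vanishes (block_mu_gt0 pW) (block_mu_sum pW)
              (block_w_itv gW pW) qi).
    by rewrite -skE.
  have [|q q0 q_lt0] := @not_condition_B' R W s.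
    by move=> B'; apply: nB'; exists s.
  apply: (separated_cover_vanishes (block_mu_gt0 pW) (block_mu_sum pW)
            (block_w_itv gW pW) q_lt0).
  by rewrite -skE.
- move=> [s1 [p1 _ A1]] [s [pW s_gt1 B]] nC.
  have A := condition_A_transfer p1 pW A1.
  have skE := skeleton_support pW; split.
    apply: (sampled_cvg1 gW sG pW (Ev := cover)).
    apply: (cover_whp (block_mu_gt0 pW) (block_mu_sum pW) (block_w_itv gW pW)).
    by rewrite -skE; apply: balance_gap.
  apply: (sampled_cvg0 gW sG pW (Ev := hamilton)).
  have : ~ condition_C W s by move=> C; apply: nC; exists s.
  move=> /existsNP[i /existsNP[j /negP]]; rewrite skE => nij.
  exact: (disconnected_hamilton_vanishes (block_mu_gt0 pW) (block_mu_sum pW)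
            (block_w_itv gW pW) nij).
- move=> [s1 [p1 _ A1]] [s [pW s_gt1 B]] [s3 [p3 s3_gt1 C3]].
  have A := condition_A_transfer p1 pW A1.
  have C := condition_C_transfer p3 pW s3_gt1 C3.
  have skE := skeleton_support pW.
  apply: (sampled_cvg1 gW sG pW (Ev := hamilton)).
  apply: (hamilton_whp (block_mu_gt0 pW) (block_mu_sum pW) (block_w_itv gW pW)).
  + by rewrite -skE; apply: balance_gap.
  + by rewrite -skE.
  + by rewrite -skE; apply: balance_in.
  + by rewrite -skE; apply: balance_out.
Qed.
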